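(* Let $g:\mathbb R^d\to[0,\infty)$ be continuously differentiable with $L$-Lipschitz gradient, let $q>1/2$, and let $$S_n=S_{n-1}+\|G_n\|^2,\qquad \theta_{n+1}=\theta_n-\alpha_0S_n^{-q}G_n,\qquad n\ge1,$$ with deterministic $\theta_1\in\mathbb R^d$, $S_0>0$ and $\alpha_0>0$. Assume that, almost surely for every $n\ge1$, $$\mathbb E[G_n\mid\mathscr F_{n-1}]=\nabla g(\theta_n),\qquad \mathbb E[\|G_n\|^2\mid\mathscr F_{n-1}]\le\beta\|\nabla g(\theta_n)\|^2+\sigma^2$$ for finite constants $\beta,\sigma\ge0$. Then $g(\theta_n)$ converges almost surely to a finite random variable and, almost surely, $$\sup_{n\ge1}g(\theta_n)<\infty,\qquad \sum_{n=1}^\infty\frac{\|\nabla g(\theta_n)\|^2}{S_{n-1}^q}<\infty .$$ If moreover $q\le1$, then $\|\nabla g(\theta_n)\|\to0$ almost surely.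
   Context: $(\Omega,\mathscr F,\mathbb P)$ is a probability space with a filtration $\{\mathscr F_n\}_{n\ge0}$. For each $n\ge1$, $\theta_n$ and $S_{n-1}$ are $\mathscr F_{n-1}$-measurable, and the stochastic gradient $G_n$ (an $\mathbb R^d$-valued random vector) is $\mathscr F_n$-measurable. $\|\cdot\|$ is the Euclidean norm. *)

(* Defs.v *)
From HB Require Import structures.
From mathcomp Require Export all_boot all_order all_algebra.
From mathcomp Require Export all_classical all_reals all_analysis.
From mathcomp Require Export measurable_realfun.
Set Implicit Arguments.
Unset Strict Implicit.
Unset Printing Implicit Defensive.
Export Order.TTheory GRing.Theory Num.Theory numFieldNormedType.Exports.
Local Open Scope classical_set_scope.
Local Open Scope ring_scope.

(* The library's norm on ['rV[R]_m] is the sup norm (it induces the same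
   topology and the same differentials), so the Euclidean one is defined here. *)
Definition enorm (R : realType) (m : nat) (x : 'rV[R]_m) : R :=
  Num.sqrt (\sum_(i < m) x ord0 i ^+ 2).

Definition grad (R : realType) (m : nat) (g : 'rV[R]_m -> R) (x : 'rV[R]_m) :
    'rV[R]_m :=
  \row_(i < m) 'D_(delta_mx ord0 i) g x.

Definition continuously_differentiable (R : realType) (m : nat)
    (g : 'rV[R]_m -> R) : Prop :=
  (forall x, differentiable g x) /\ continuous (grad g).

Definition filtration (d : measure_display) (T : measurableType d)
    (F : nat -> set (set T)) : Prop :=
  [/\ forall n, sigma_algebra [set: T] (F n),
      forall n, F n `<=` measurable &
      forall n k, (n <= k)%N -> F n `<=` F k].

(* [g_sigma_algebraType F] is [T] equipped with the sigma-algebra generated by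
   [F], which is [F] itself when [F] is a sigma-algebra. *)
Definition measurable_wrt (d d' : measure_display) (T : measurableType d)
    (U : measurableType d') (F : set (set T)) (f : T -> U) : Prop :=
  measurable_fun [set: g_sigma_algebraType F] (f : g_sigma_algebraType F -> U).

Definition vec_measurable_wrt (d : measure_display) (T : measurableType d)
    (R : realType) (m : nat) (F : set (set T)) (f : T -> 'rV[R]_m) : Prop :=
  forall i, measurable_wrt F (fun w => f w ord0 i : R).

(* [Y] is a version of E[X | F], where [X] is integrable or nonnegative (in the
   latter case [X] need not be integrable and [Y] may take the value [+oo]). *)
Definition cond_exp_version (d : measure_display) (T : measurableType d)
    (R : realType) (P : probability T R) (F : set (set T))
    (X Y : T -> \bar R) : Prop :=
  [/\ P.-integrable [set: T] X \/
        (measurable_fun [set: T] X /\ forall w, (0 <= X w)%E),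
      measurable_wrt F Y &
      forall A, F A -> (\int[P]_(w in A) Y w = \int[P]_(w in A) X w)%E].

Definition vec_cond_exp_version (d : measure_display) (T : measurableType d)
    (R : realType) (P : probability T R) (m : nat) (F : set (set T))
    (X Y : T -> 'rV[R]_m) : Prop :=
  forall i, cond_exp_version P F
    (fun w => (X w ord0 i)%:E) (fun w => (Y w ord0 i)%:E).

(* Main.v *)
From HB Require Import structures.
Require Import Defs.
From mathcomp Require Import ring lra.
Local Open Scope classical_set_scope.
Local Open Scope ring_scope.
Set Implicit Arguments.
Unset Strict Implicit.
Unset Printing Implicit Defensive.

(** The descent inequality makes [g (theta_n)] a supermartingale up to two defects: the step
    size [S_n^-q] depends on the gradient [G_n] that it multiplies, and the second moment of
    [G_n] grows with [|grad g (theta_n)|]. Shift the indices so that [S_n] is known before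
    [G_n] is drawn and [S_(n+1) = S_n + |G_n|^2], and write [N_n = |grad g (theta_n)|]. Both
    defects are repaired by one energy,
      [U_n = g (theta_n) + alpha beta S_n^-q N_n^2 + alpha s2 S_n^-q + K' S_n^(1 - 2q)].
    Replacing [S_(n+1)^-q] by [S_n^-q] in the descent inequality costs
    [(S_n^-q - S_(n+1)^-q) <grad g, G_n>]. By a weighted AM-GM inequality this is at most
    [lam S_n^-q |G_n|^2 + (S_n^-q - S_(n+1)^-q) (beta N_n^2 + s2)], where the weight [lam] is
    chosen so that [lam |G_n|^2] has conditional mean at most [N_n^2 / 4]. The [s2] part
    telescopes, and so does the [beta] part once [N_n] is replaced by [N_(n+1)] in
    [S_(n+1)^-q N_n^2]; that replacement costs [S_n^-q N_n^2 / 4] and a multiple of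
    [S_(n+1)^(-2q) |G_n|^2]. Since [|G_n|^2] is the increment of [S] and [2q > 1], the latter
    is dominated by a decrement of [S^(1 - 2q)] ([power_increment]). All this holds along
    each path ([lyapunov_step]); taking conditional expectations ([Rintegral_pull_out],
    [le_Rintegral_pull_out]) gives
      [E[U_(n+1) | F_n] <= U_n - alpha / 2 S_n^-q N_n^2].

    Every [U_n] is a bounded nonnegative variable, because the steps are bounded by a
    constant, so no localization is needed. Summing the inequality bounds
    [E sum S_n^-q N_n^2], which gives the series. Doob's theorem ([supermartingale_cvg],
    proved by counting upcrossings) gives convergence of [U_n], hence of [g (theta_n)], the
    other terms of the energy being convergent.

    For [q <= 1], the same bound shows that [S_n^-q |G_n|^2], summed over the times with
    [N_n > e], is almost surely finite for every [e > 0]. What remains is deterministic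
    ([gradient_to_zero]). If [N_n > e] from some time on, then [sum (S_(n+1) - S_n) / S_n]
    converges, [S] is bounded and [sum S_n^-q N_n^2] diverges; so [N_n <= e] infinitely
    often. Since moreover the path travelled while [N_n > e] has finite length and single
    steps tend to zero, [N_n] cannot exceed [3 e] infinitely often. *)

(** * Euclidean norm and descent inequality *)

Section Euclidean.
Context (R : realType) (m : nat).
Implicit Types x y z : 'rV[R]_m.

Definition dotr x y : R := \sum_(i < m) x ord0 i * y ord0 i.

Lemma enorm_ge0 x : 0 <= enorm x.
Proof. exact: sqrtr_ge0. Qed.

Lemma enorm_sqr x : enorm x ^+ 2 = dotr x x.
Proof.
rewrite /enorm sqr_sqrtr; first by apply: eq_bigr => i _; rewrite expr2.
by apply: sumr_ge0 => i _; exact: sqr_ge0.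
Qed.

Lemma dotr_sumsqr x y (a b : R) :
  \sum_(i < m) (a * x ord0 i - b * y ord0 i) ^+ 2 =
  a ^+ 2 * dotr x x - 2 * a * b * dotr x y + b ^+ 2 * dotr y y.
Proof.
rewrite /dotr !mulr_sumr -sumrB -big_split /=.
by apply: eq_bigr => i _; ring.
Qed.

Lemma normr_coord_le x i : `|x ord0 i| <= enorm x.
Proof.
rewrite -(@ler_pXn2r _ 2)// ?nnegrE ?enorm_ge0// enorm_sqr real_normK ?num_real//.
rewrite /dotr (bigD1 i)//= -expr2 lerDl.
by apply: sumr_ge0 => j _; rewrite -expr2 sqr_ge0.
Qed.

Lemma enorm_eq0_coord x i : enorm x = 0 -> x ord0 i = 0.
Proof. by move=> x0; apply/eqP; rewrite -normr_le0 -x0 normr_coord_le. Qed.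

(** Cauchy-Schwarz, from the nonnegativity of [| |y| x - |x| y |^2]. *)
Lemma dotr_le_enorm x y : dotr x y <= enorm x * enorm y.
Proof.
have [x0|x0] := eqVneq (enorm x) 0.
  by rewrite x0 mul0r /dotr big1// => i _; rewrite enorm_eq0_coord ?mul0r.
have [y0|y0] := eqVneq (enorm y) 0.
  by rewrite y0 mulr0 /dotr big1// => i _; rewrite (enorm_eq0_coord _ y0) mulr0.
have xp : 0 < enorm x by rewrite lt_def x0 enorm_ge0.
have yp : 0 < enorm y by rewrite lt_def y0 enorm_ge0.
have : 0 <= \sum_(i < m) (enorm y * x ord0 i - enorm x * y ord0 i) ^+ 2.
  by apply: sumr_ge0 => i _; exact: sqr_ge0.
rewrite dotr_sumsqr -!enorm_sqr => E.
have xy : 0 < enorm x * enorm y by rewrite mulr_gt0.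
rewrite -(ler_pM2l xy); nra.
Qed.

Lemma enorm_le_sqr x (a : R) : 0 <= a -> dotr x x <= a ^+ 2 -> enorm x <= a.
Proof. by move=> a0; rewrite -enorm_sqr ler_pXn2r// nnegrE enorm_ge0. Qed.

Lemma ler_enormD x y : enorm (x + y) <= enorm x + enorm y.
Proof.
apply: enorm_le_sqr; first by rewrite addr_ge0// enorm_ge0.
have -> : dotr (x + y) (x + y) = dotr x x + 2 * dotr x y + dotr y y.
  rewrite /dotr mulr_sumr -!big_split /=.
  by apply: eq_bigr => i _; rewrite !mxE; ring.
rewrite -!enorm_sqr; have := dotr_le_enorm x y; nra.
Qed.

Lemma enormZ (a : R) x : enorm (a *: x) = `|a| * enorm x.
Proof.
rewrite /enorm -sqrtr_sqr -sqrtrM ?sqr_ge0//; congr Num.sqrt.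
by rewrite mulr_sumr; apply: eq_bigr => i _; rewrite mxE exprMn.
Qed.

Lemma enormN x : enorm (- x) = enorm x.
Proof. by rewrite -scaleN1r enormZ normrN1 mul1r. Qed.

Lemma dotrBl x y z : dotr (x - y) z = dotr x z - dotr y z.
Proof. by rewrite /dotr -sumrB; apply: eq_bigr => i _; rewrite !mxE mulrBl. Qed.

Lemma dotrN x y : dotr x (- y) = - dotr x y.
Proof. by rewrite /dotr -sumrN; apply: eq_bigr => i _; rewrite !mxE mulrN. Qed.

Lemma dotrZr (a : R) x y : dotr x (a *: y) = a * dotr x y.
Proof.
by rewrite /dotr mulr_sumr; apply: eq_bigr => i _; rewrite mxE mulrCA.
Qed.

End Euclidean.

Section Descent.
Context (R : realType) (m : nat) (g : 'rV[R]_m -> R) (L : R).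
Hypothesis dg : forall x, differentiable g x.
Hypothesis lipg : forall x y, enorm (grad g x - grad g y) <= L * enorm (x - y).

Lemma derive_grad x v : 'D_v g x = dotr (grad g x) v.
Proof.
rewrite deriveE//.
have -> : 'd g x v = 'd g x (\sum_i v ord0 i *: delta_mx ord0 i).
  by rewrite -row_sum_delta.
rewrite linear_sum; apply: eq_bigr => i _.
by rewrite linearZ /= mxE deriveE// mulrC.
Qed.

Lemma is_derive_line x v (t : R) :
  is_derive t 1 (fun t : R => g (x + t *: v)) (dotr (grad g (x + t *: v)) v).
Proof.
have E : (fun h : R => h^-1 *: (g (x + (h *: (1:R) + t) *: v) - g (x + t *: v)))
   = (fun h : R => h^-1 *: (g (h *: v + (x + t *: v)) - g (x + t *: v))).
  apply/funext => h; congr (_ *: (g _ - _)).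
  by rewrite scalerDl addrCA /GRing.scale /= mulr1.
apply: DeriveDef.
  rewrite /derivable /= E; exact: diff_derivable.
by rewrite -derive_grad /derive /= E.
Qed.

(** Along the segment, the derivative at time [t] differs from the initial one by at most
    [L t |v|^2], and [L t |v|^2] integrates to [L / 2 |v|^2]. *)
Lemma descent x v :
  g (x + v) <= g x + dotr (grad g x) v + L / 2 * enorm v ^+ 2.
Proof.
pose h (t : R) := g (x + t *: v) - (t * dotr (grad g x) v + t ^+ 2 * (L / 2 * enorm v ^+ 2)).
have dh (t : R) : is_derive t 1 h (dotr (grad g (x + t *: v)) v -
     (dotr (grad g x) v + 2 * t * (L / 2 * enorm v ^+ 2))).
  rewrite /h; have D := is_derive_line x v t.
  apply: is_derive_eq.
  by rewrite /GRing.scale /=; ring.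
have [c c01 ] : exists2 c, c \in `]0, 1[%R & h 1 - h 0 =
   (dotr (grad g (x + c *: v)) v -
     (dotr (grad g x) v + 2 * c * (L / 2 * enorm v ^+ 2))) * (1 - 0).
  apply: (@MVT _ h (fun t => dotr (grad g (x + t *: v)) v -
     (dotr (grad g x) v + 2 * t * (L / 2 * enorm v ^+ 2))) 0 1 ltr01) => //.
  apply: derivable_within_continuous => t _; exact: (@ex_derive _ _ _ _ _ _ _ (dh t)).
move: c01; rewrite in_itv/= => /andP[c0 c1].
rewrite subr0 mulr1 /h !scale0r !scale1r !addr0 expr0n/= !mul0r addr0 subr0 !mul1r expr1n mul1r.
have B : dotr (grad g (x + c *: v)) v - dotr (grad g x) v <= L * c * enorm v ^+ 2.
  rewrite -dotrBl (le_trans (dotr_le_enorm _ _))//.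
  rewrite expr2 mulrA ler_wpM2r ?enorm_ge0//.
  rewrite (le_trans (lipg _ _))// addrAC subrr add0r enormZ gtr0_norm// mulrA//.
move=> E; lra.
Qed.

End Descent.

(** * Pathwise estimates *)

Section BoundedSums.
Context (R : realType).
Implicit Types u v : nat -> R.

(** For nonnegative terms this is convergence of the series; it is the form in which sums
    are bounded below, and it avoids extended reals in the pathwise arguments. *)
Definition bounded_sums u := exists M, forall n, \sum_(0 <= k < n) u k <= M.

Lemma le_bounded_sums u v : (forall n, v n <= u n) -> bounded_sums u -> bounded_sums v.
Proof.
by move=> vu [M uM]; exists M => n; rewrite (le_trans _ (uM n))// ler_sum.
Qed.

Lemma bounded_sumsD u v : bounded_sums u -> bounded_sums v -> bounded_sums (fun n => u n + v n).
Proof.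
move=> [M uM] [K vK]; exists (M + K) => n.
by rewrite big_split/= lerD.
Qed.

Lemma bounded_sumsZ (c : R) u : 0 <= c -> bounded_sums u -> bounded_sums (fun n => c * u n).
Proof.
by move=> c0 [M uM]; exists (c * M) => n; rewrite -mulr_sumr ler_wpM2l.
Qed.

Lemma bounded_sums_tail u : (forall n, 0 <= u n) -> bounded_sums u ->
  forall e, 0 < e -> exists M, forall n p, (M <= n)%N -> \sum_(n <= k < p) u k <= e.
Proof.
move=> u0 [B uB] e e0.
pose A := range (fun n => \sum_(0 <= k < n) u k).
have hA : has_sup A.
  split; first by exists (\sum_(0 <= k < 0) u k), 0%N.
  by exists B => _ [n _ <-].
have [_ [M _ <-] AM] := sup_adherent e0 hA.
exists M => n p Mn; case: (leqP n p) => [np|/ltnW pn]; last by rewrite big_geq// ltW.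
have Sp : \sum_(0 <= k < p) u k <= sup A by apply: ub_le_sup; [exact: hA.2|exists p].
have Mn' : \sum_(0 <= k < M) u k <= \sum_(0 <= k < n) u k.
  by rewrite (big_cat_nat (leq0n M) Mn)/= lerDl sumr_ge0.
move: Sp; rewrite (big_cat_nat (leq0n n) np)/= => Sp; lra.
Qed.

Lemma bounded_sums_small u : (forall n, 0 <= u n) -> bounded_sums u ->
  forall e, 0 < e -> exists M, forall n, (M <= n)%N -> u n <= e.
Proof.
move=> u0 /(bounded_sums_tail u0) H e /H[M HM]; exists M => n Mn.
by have := HM n n.+1 Mn; rewrite big_nat1.
Qed.

Lemma bounded_sums_bool (c : nat -> bool) :
  bounded_sums (fun n => (c n)%:R) -> exists M, forall n, (M <= n)%N -> ~~ c n.
Proof.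
move=> H; have e0 : 0 < 2^-1 :> R by rewrite invr_gt0.
have [M HM] := bounded_sums_small (fun n => ler0n R (c n)) H e0.
by exists M => n /HM; case: (c n) => //=; lra.
Qed.

End BoundedSums.

Section Power.
Context (R : realType).
Implicit Types s t q : R.

(** With [r = 2 q - 1 > 0] this is [t^-r (s / t)^-r >= t^-r (1 + r (1 - s / t))],
    the convexity of [u |-> u^-r]. *)
Lemma power_increment s t q : 0 < s -> s <= t -> 1 / 2 < q ->
  (t - s) * (t `^ (- q)) ^+ 2 <= (s `^ (1 - 2 * q) - t `^ (1 - 2 * q)) / (2 * q - 1).
Proof.
move=> s0 st q0; have t0 : 0 < t := lt_le_trans s0 st.
have r0 : 0 < 2 * q - 1 by lra.
rewrite ler_pdivlMr//.
have -> : (t `^ (- q)) ^+ 2 = t `^ (1 - 2 * q) / t.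
  rewrite expr2 -powRD; last by rewrite (gt_eqF t0) implybT.
  rewrite -[X in _ / X](powRr1 (ltW t0)) -powRB ?(gt_eqF t0) ?implybT//; congr powR; lra.
have -> : s `^ (1 - 2 * q) = t `^ (1 - 2 * q) * expR ((2 * q - 1) * (ln t - ln s)).
  rewrite /powR (gt_eqF s0) (gt_eqF t0) -expRD; congr expR; ring.
have l : 1 - s / t <= ln t - ln s.
  have : ln (1 + (s / t - 1)) <= s / t - 1.
    by apply: le_ln1Dx; rewrite ltrBrDl addrN divr_gt0.
  rewrite addrC subrK ln_div ?posrE//; lra.
have : 1 + (2 * q - 1) * (1 - s / t) <= expR ((2 * q - 1) * (ln t - ln s)).
  by rewrite (le_trans _ (expR_ge1Dx _))// lerD2l ler_wpM2l// ltW.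
have := powR_gt0 (1 - 2 * q) t0.
have -> : (t - s) * (t `^ (1 - 2 * q) / t) = t `^ (1 - 2 * q) * (1 - s / t).
  by field; rewrite gt_eqF.
nra.
Qed.

Lemma power_decreasing s t q : 0 < s -> s <= t -> 0 <= q -> t `^ (- q) <= s `^ (- q).
Proof.
move=> s0 st q0; rewrite !powRN lef_pV2 ?posrE ?powR_gt0//; last exact: lt_le_trans st.
by apply: ge0_ler_powR => //; rewrite nnegrE ltW// (lt_le_trans s0).
Qed.

End Power.

(** One step of the algorithm along a single path, with [x = S_n^-q], [y = S_(n+1)^-q],
    [N] and [N'] the gradient norms before and after the step, [gam = |G_n|] and
    [p = <grad g, G_n>]. Trading the step size [y], which depends on [G_n], for [x] costs
    [(x - y) p]. This is split so that the part quadratic in [gam] has small conditional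
    expectation, while the part [(x - y) (beta N^2 + s2)] telescopes: [y N^2] is compared
    with [y N'^2], the difference being controlled by the Lipschitz constant. *)
Lemma lyapunov_step (R : realType) (L alpha beta s2 x0 x y g g' N N' gam p : R) :
  0 <= L -> 0 < alpha -> 0 <= beta -> 0 < s2 -> 0 < y -> y <= x -> x <= x0 ->
  0 <= N -> 0 <= N' -> 0 <= gam -> p <= N * gam ->
  N' <= N + L * (alpha * y * gam) ->
  g' <= g - alpha * y * p + L / 2 * (alpha * y * gam) ^+ 2 ->
  g' + alpha * beta * (y * N' ^+ 2) + alpha * s2 * y <=
  g + alpha * beta * (x * N ^+ 2) + alpha * s2 * x
   - alpha * (x * p)
   + alpha * (N ^+ 2 / (4 * (beta * N ^+ 2 + s2)) * x * gam ^+ 2)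
   + alpha / 4 * (x * N ^+ 2)
   + (L * alpha ^+ 2 / 2 + alpha * beta *
       ((L * alpha) ^+ 2 * (4 * (beta + 1) * x0) + (L * alpha) ^+ 2 * x0))
      * (y * gam) ^+ 2.
Proof.
move=> L0 a0 b0 s20 y0 yx xx0 N0 N'0 gam0 pN N'N gg.
have x0p : 0 < x0 by lra.
set B := beta * N ^+ 2 + s2; set lam := N ^+ 2 / (4 * B).
have B0 : 0 < B by rewrite /B ltr_wpDl// mulr_ge0// sqr_ge0.
have lam0 : 0 <= lam by rewrite /lam divr_ge0 ?sqr_ge0// mulr_ge0// ltW.
have lamB : 4 * lam * B = N ^+ 2 by rewrite /lam; field; rewrite gt_eqF.
(* [lam] is the weight for which [lam gam^2] has conditional mean at most [N^2 / 4]. *)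
have H1 : N * gam <= lam * gam ^+ 2 + B.
  have r0 : 0 <= lam * gam ^+ 2 + B by rewrite addr_ge0 ?(ltW B0)// mulr_ge0// sqr_ge0.
  rewrite -(@ler_pXn2r _ 2)// ?nnegrE ?mulr_ge0//.
  rewrite exprMn -lamB; have := sqr_ge0 (lam * gam ^+ 2 - B); nra.
have H2 : (x - y) * p <= lam * x * gam ^+ 2 + (x - y) * B.
  apply: (@le_trans _ _ ((x - y) * (lam * gam ^+ 2 + B))).
    by rewrite ler_wpM2l ?subr_ge0//; lra.
  have : 0 <= y * (lam * gam ^+ 2).
    by rewrite mulr_ge0 ?(ltW y0)// mulr_ge0// sqr_ge0.
  nra.
set K := L * alpha; set e := y * gam.
have K0 : 0 <= K by rewrite mulr_ge0// ltW.
have e0 : 0 <= e by rewrite mulr_ge0// ltW.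
have H3 : N' ^+ 2 <= (N + K * e) ^+ 2.
  have Ke0 : 0 <= N + K * e by rewrite addr_ge0// mulr_ge0.
  rewrite ler_pXn2r ?nnegrE//.
  by rewrite (le_trans N'N)// /K /e; lra.
(* The weight [T] makes the resulting multiple of [x N^2] at most one quarter. *)
set T := 4 * (beta + 1) * x0.
have T0 : 0 < T by rewrite /T !mulr_gt0//; lra.
have H4 : 2 * (K * e) * (y * N) <= (K * e) ^+ 2 * T + (y * N) ^+ 2 / T.
  rewrite -subr_ge0.
  have -> : (K * e) ^+ 2 * T + (y * N) ^+ 2 / T - 2 * (K * e) * (y * N) =
     (K * e * T - y * N) ^+ 2 / T by field; rewrite gt_eqF.
  by rewrite divr_ge0 ?sqr_ge0// ltW.
have H5 : beta * ((y * N) ^+ 2 / T) <= x * N ^+ 2 / 4.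
  have y2 : y ^+ 2 <= x0 * x by rewrite expr2; nra.
  have : beta * (y * N) ^+ 2 <= (beta + 1) * x0 * (x * N ^+ 2).
    rewrite exprMn.
    have N2 := sqr_ge0 N.
    apply: (@le_trans _ _ (beta * ((x0 * x) * N ^+ 2))); first by rewrite ler_wpM2l// ler_wpM2r.
    have : 0 <= x0 * x * N ^+ 2 by rewrite mulr_ge0// mulr_ge0; lra.
    nra.
  by rewrite [beta * (_ / T)]mulrA ler_pdivrMr// /T => h; lra.
have H6 : y * N' ^+ 2 <= y * N ^+ 2 + (K * e) ^+ 2 * T + (y * N) ^+ 2 / T + K ^+ 2 * x0 * e ^+ 2.
  apply: (@le_trans _ _ (y * (N + K * e) ^+ 2)); first by rewrite ler_pM2l.
  have : y * (K * e) ^+ 2 <= x0 * (K * e) ^+ 2.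
    by rewrite ler_wpM2r ?sqr_ge0//; lra.
  nra.
have H7 : beta * (y * N' ^+ 2) <= beta * (y * N ^+ 2) + x * N ^+ 2 / 4 +
    beta * (K ^+ 2 * T + K ^+ 2 * x0) * e ^+ 2.
  have := ler_wpM2l b0 H6; nra.
have H8 : g' <= g - alpha * y * p + L * alpha ^+ 2 / 2 * e ^+ 2.
  by move: gg; rewrite /e; rewrite [X in _ <= X -> _](_ : _ = g - alpha * y * p + L * alpha ^+ 2 / 2 * (y * gam) ^+ 2)//; field.
move: H2; rewrite /B => H2.
have H9 : 0 <= alpha * (lam * x * gam ^+ 2 + (x - y) * (beta * N ^+ 2 + s2) - (x - y) * p).
  by rewrite mulr_ge0 ?(ltW a0)// subr_ge0.
have H10 : 0 <= alpha * (beta * (y * N ^+ 2) + x * N ^+ 2 / 4 +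
    beta * (K ^+ 2 * T + K ^+ 2 * x0) * e ^+ 2 - beta * (y * N' ^+ 2)).
  by rewrite mulr_ge0 ?(ltW a0)// subr_ge0.
lra.
Qed.

Section Upcrossings.
Context (R : realType) (u : nat -> R) (a b : R).

(** The strategy that buys below [a] and sells above [b]. *)
Fixpoint holding n : bool :=
  if n is k.+1 then (if holding k then u k.+1 <= b else u k.+1 < a) else u 0%N < a.

Definition sale n := holding n && ~~ holding n.+1.

(** Each completed round trip earns at least [b - a], and the share currently held, if any,
    was bought below [a]. *)
Lemma gain_ge_sales n :
  (b - a) * (\sum_(0 <= k < n) (sale k)%:R) + (holding n)%:R * (u n - a) <=
  \sum_(0 <= k < n) (holding k)%:R * (u k.+1 - u k).
Proof.
elim: n => [|n IH].
  by rewrite !big_geq// mulr0 add0r /=; case: ltP => /= ?; rewrite ?mul1r ?mul0r; lra.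
rewrite !big_nat_recr//= /sale /=; move: IH.
by case: (holding n) => /=; [case: (leP (u n.+1) b)|case: (ltP (u n.+1) a)] => /= ? ?; lra.
Qed.

(** Once no sale occurs any more, the strategy stays invested or stays out forever. *)
Lemma no_crossing : bounded_sums (fun n => (sale n)%:R : R) ->
  (exists M, forall n, (M <= n)%N -> u n <= b) \/
  (exists M, forall n, (M <= n)%N -> a <= u n).
Proof.
move=> /bounded_sums_bool[M HM].
have [[k Mk hk]|nh] := pselect (exists2 k, (M <= k)%N & holding k).
  have H n : holding (k + n).
    elim: n => [|n IH]; first by rewrite addn0.
    by have := HM _ (leq_trans Mk (leq_addr n k)); rewrite /sale IH/= addnS negbK.
  left; exists k.+1 => -[//|n] kn; have := H (n.+1 - k)%N; have := H (n - k)%N.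
  by rewrite !subnKC// 1?ltnW//= => ->.
right; exists M.+1 => -[//|n] kn; rewrite leNgt; apply/negP => una.
have hn : ~~ holding n by apply/negP => h; apply: nh; exists n.
by apply: nh; exists n.+1; [exact: ltnW|rewrite /= (negbTE hn)].
Qed.

End Upcrossings.

(** The limit is the supremum of the eventual lower bounds of [u]: a number slightly larger
    is not an eventual lower bound, so by the dichotomy it is nearly an eventual upper
    bound. *)
Lemma no_crossing_cvg (R : realType) (u : nat -> R) (B0 : R) :
  (forall n, B0 <= u n) -> (exists K M, forall n, (M <= n)%N -> u n <= K) ->
  (forall a b : R, a < b ->
    (exists M, forall n, (M <= n)%N -> u n <= b) \/
    (exists M, forall n, (M <= n)%N -> a <= u n)) ->
  cvgn u.
Proof.
move=> u0 [K [MK HK]] cr.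
pose A := [set a | exists M, forall n, (M <= n)%N -> a <= u n].
have A0 : A B0 by exists 0%N.
have hA : has_sup A.
  split; first by exists B0.
  exists K => a [M aM]; apply: (le_trans (aM (maxn M MK) (leq_maxl _ _))).
  exact: HK (leq_maxr _ _).
apply/cvg_ex; exists (sup A); apply/cvgrPdist_le => e e0.
have [a [M aM] aS] := sup_adherent e0 hA.
have [[N bN]|[N aN]] := cr (sup A + e / 2) (sup A + e) ltac:(lra); last first.
  have : A (sup A + e / 2) by exists N.
  by move=> /(ub_le_sup hA.2) /=; lra.
exists (maxn M N) => // n /=; rewrite geq_max => /andP[Mn Nn].
rewrite ler_norml; have := aM _ Mn; have := bN _ Nn; lra.
Qed.

Lemma has_rat_between (R : realType) (a b : R) : a < b ->
  exists r s : rat, [/\ a <= ratr r, ratr r < ratr s :> R & ratr s <= b].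
Proof.
move=> ab; have [r] := rat_in_itvoo ab; rewrite in_itv/= => /andP[ar rb].
have [s] := rat_in_itvoo rb; rewrite in_itv/= => /andP[rs sb].
by exists r, s; split => //; exact: ltW.
Qed.

Section GradientToZero.
Context (R : realType) (q c : R) (s gam N : nat -> R).
Hypothesis q_le1 : q <= 1.
Hypothesis q_gt : 1 / 2 < q.
Hypothesis c_ge0 : 0 <= c.
Hypothesis s0_gt0 : 0 < s 0%N.
Hypothesis s_rec : forall n, s n.+1 = s n + gam n ^+ 2.
Hypothesis gam_ge0 : forall n, 0 <= gam n.
Hypothesis N_ge0 : forall n, 0 <= N n.
Hypothesis N_rec : forall n, N n.+1 <= N n + c * (s n.+1 `^ (- q) * gam n).
Hypothesis sum_N : bounded_sums (fun n => s n `^ (- q) * N n ^+ 2).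
Hypothesis sum_gam : forall e : R, 0 < e ->
  bounded_sums (fun n => (e < N n)%R%:R * (s n `^ (- q) * gam n ^+ 2)).

Let q_ge0 : 0 <= q. Proof. by move: q_gt; lra. Qed.

Let s_nd n k : (n <= k)%N -> s n <= s k.
Proof.
move/subnKC <-; elim: (k - n)%N => [|i IH]; first by rewrite addn0.
by rewrite addnS s_rec (le_trans IH)// lerDl sqr_ge0.
Qed.

Let s_gt0 n : 0 < s n.
Proof. exact: lt_le_trans (s_nd (leq0n n)). Qed.

Let x_ge0 n : 0 <= s n `^ (- q).
Proof. exact: powR_ge0. Qed.

(** [sum_n s_(n+1)^(-2q) (s_(n+1) - s_n)] is bounded by the integral of [s^(-2q)]. *)
Let sum_step : bounded_sums (fun n => (s n.+1 `^ (- q) * gam n) ^+ 2).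
Proof.
exists (s 0%N `^ (1 - 2 * q) / (2 * q - 1)) => n.
apply: (@le_trans _ _ (\sum_(0 <= k < n)
    (- (s k.+1 `^ (1 - 2 * q) / (2 * q - 1)) - - (s k `^ (1 - 2 * q) / (2 * q - 1))))).
  apply: ler_sum => k _.
  have := power_increment (s_gt0 k) (s_nd (leqnSn k)) q_gt.
  rewrite {1}s_rec addrC addKr exprMn mulrC mulrBl; lra.
rewrite telescope_sumr//.
have r0 : 0 < 2 * q - 1 by move: q_gt; lra.
have := powR_ge0 (s n) (1 - 2 * q); have : 0 < (2 * q - 1)^-1 by rewrite invr_gt0.
nra.
Qed.

(** Otherwise [sum s_n^-q (s_(n+1) - s_n)] converges; since [q <= 1] this bounds [s], and
    then [sum s_n^-q N_n^2] diverges. *)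
Let N_liminf e M : 0 < e -> exists2 n, (M <= n)%N & N n <= e.
Proof.
move=> e0; apply: contrapT => H.
have {}H n : (M <= n)%N -> e < N n.
  by move=> Mn; rewrite ltNge; apply/negP => h; apply: H; exists n.
have [D HD] := sum_gam e0.
pose K := s 0%N `^ (1 - q).
have K0 : 0 < K by exact: powR_gt0.
have xK n : K * (s n)^-1 <= s n `^ (- q).
  have -> : s n `^ (- q) = s n `^ (1 - q) * (s n)^-1.
    by rewrite -powR_inv1 ?(ltW (s_gt0 n))// -powRD ?(gt_eqF (s_gt0 n)) ?implybT//; congr powR; ring.
  rewrite ler_pM2r ?invr_gt0// /K ge0_ler_powR// ?nnegrE ?subr_ge0//.
  - exact: ltW.
  - exact: ltW.
  - exact: s_nd.
(* [d n] dominates the relative increment [(s_(n+1) - s_n) / s_n] from time [M] on. *)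
pose d n := (e < N n)%R%:R * (s n `^ (- q) * gam n ^+ 2) / K.
have s_le n : s (M + n)%N <= s M * expR (\sum_(M <= k < M + n) d k).
  elim: n => [|n IH]; first by rewrite addn0 big_geq// expR0 mulr1.
  rewrite addnS big_nat_recr ?leq_addr//= expRD mulrA.
  apply: (@le_trans _ _ (s (M + n)%N * expR (d (M + n)%N))); last by rewrite ler_wpM2r// expR_ge0.
  apply: (@le_trans _ _ (s (M + n)%N * (1 + d (M + n)%N))); last first.
    by rewrite ler_wpM2l ?expR_ge1Dx// ltW.
  rewrite s_rec mulrDr mulr1 lerD2l /d H ?leq_addr//= mul1r.
  have := s_gt0 (M + n)%N; have := xK (M + n)%N.
  set k := (M + n)%N; rewrite ler_pdivrMr ?s_gt0// => xk sk.
  rewrite mulrA ler_pdivlMr// mulrA mulrC.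
  by rewrite ler_wpM2r ?sqr_ge0// mulrC.
have s_bd n : (M <= n)%N -> s n <= s M * expR (D / K).
  move=> /subnKC <-; apply: (le_trans (s_le _)).
  rewrite ler_wpM2l ?(ltW (s_gt0 _))// ler_expR -mulr_suml ler_wpM2r ?invr_ge0 ?(ltW K0)//.
  apply: le_trans (HD (M + (n - M))%N).
  rewrite [leRHS](big_cat_nat (leq0n M) (leq_addr _ _))/= lerDr.
  by apply: sumr_ge0 => k _; rewrite mulr_ge0// ?ler0n// mulr_ge0// sqr_ge0.
pose eta := (s M * expR (D / K)) `^ (- q) * e ^+ 2.
have Bpos : 0 < s M * expR (D / K) by rewrite mulr_gt0// ?s_gt0// expR_gt0.
have eta0 : 0 < eta by rewrite mulr_gt0// ?powR_gt0// exprn_gt0.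
have xN0 n : 0 <= s n `^ (- q) * N n ^+ 2 by rewrite mulr_ge0// sqr_ge0.
have eta20 : 0 < eta / 2 by rewrite divr_gt0.
have [M' HM'] := bounded_sums_small xN0 sum_N eta20.
have := HM' (maxn M M') (leq_maxr _ _); apply/negP; rewrite -ltNge.
set n := maxn M M'; have Mn : (M <= n)%N := leq_maxl _ _.
apply: (@lt_le_trans _ _ eta); first lra.
rewrite ler_pM ?powR_ge0 ?sqr_ge0//; first by apply: power_decreasing => //; exact: s_bd.
by rewrite ler_pXn2r// ?nnegrE ?N_ge0 ?(ltW e0) ?(ltW (H _ Mn)).
Qed.

(** The total increase of [N] over the times with [N > e] is finite, because
    [s^-q gam <= s^-q (1 + gam^2)] and [s^-q <= s^-q N^2 / e^2] at these times; moreover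
    single increments vanish. Hence [N <= 3 e] from a late visit to [[0, e]] on. *)
Lemma gradient_to_zero : N n @[n --> \oo] --> (0 : R).
Proof.
apply/cvgrPdist_le => e1 e1_gt0.
pose e := e1 / 3; have e0 : 0 < e by rewrite divr_gt0.
pose r n := (e < N n)%R%:R * (c * (s n.+1 `^ (- q) * gam n)).
have t_ge0 n : 0 <= c * (s n.+1 `^ (- q) * gam n) by rewrite mulr_ge0// mulr_ge0.
have r_ge0 n : 0 <= r n by rewrite mulr_ge0.
have r_sum : bounded_sums r.
  have H1 := bounded_sumsZ (c := c / e ^+ 2) _ sum_N.
  have H2 := bounded_sumsZ c_ge0 (sum_gam e0).
  apply: le_bounded_sums (bounded_sumsD (H1 _) H2); last by rewrite divr_ge0// sqr_ge0.
  move=> n; rewrite /r; case: (ltP e (N n)) => eN; last first.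
    by rewrite !mul0r mulr0 addr0 mulr_ge0// ?divr_ge0// ?sqr_ge0// mulr_ge0// sqr_ge0.
  rewrite !mul1r -mulrA -mulrDr ler_wpM2l//.
  apply: (@le_trans _ _ (s n `^ (- q) * (1 + gam n ^+ 2))).
    rewrite ler_pM//; last by have := sqr_ge0 (gam n - 1); have := sqr_ge0 (gam n); rewrite !expr2; nra.
    by apply: power_decreasing => //; exact: s_nd.
  rewrite mulrDr mulr1 lerD2r mulrCA ler_peMr//.
  by rewrite mulrC ler_pdivlMr ?exprn_gt0// mul1r ler_pXn2r// ?nnegrE ?N_ge0 ?(ltW e0) ?(ltW eN).
have [M1 HM1] := bounded_sums_tail r_ge0 r_sum e0.
have c1 : 0 < c + 1 by rewrite ltr_wpDl.
have e2 : 0 < (e / (c + 1)) ^+ 2 by rewrite exprn_gt0// divr_gt0.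
have [M2 HM2] := bounded_sums_small (fun n => sqr_ge0 (s n.+1 `^ (- q) * gam n)) sum_step e2.
have [M Mge NM] := N_liminf (maxn M1 M2) e0.
have [M1M M2M] : (M1 <= M)%N /\ (M2 <= M)%N by move: Mge; rewrite geq_max => /andP.
have t_small n : (M <= n)%N -> c * (s n.+1 `^ (- q) * gam n) <= e.
  move=> Mn; have := HM2 n (leq_trans M2M Mn).
  have ec0 : 0 <= e / (c + 1) by rewrite divr_ge0// ltW.
  rewrite ler_pXn2r ?nnegrE ?ec0 ?mulr_ge0//.
  rewrite ler_pdivlMr//.
  have := mulr_ge0 (x_ge0 n.+1) (gam_ge0 n); lra.
(* After a visit to [[0, e]] the next value is at most [2 e], and while the sequence
   stays above [e] it increases by the terms of [r] only. *)
have main n : N (M + n)%N <= 2 * e + \sum_(M <= k < M + n) r k.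
  elim: n => [|n IH]; first by rewrite addn0 big_geq//; lra.
  rewrite addnS big_nat_recr ?leq_addr//=.
  apply: (le_trans (N_rec _)).
  have sr : 0 <= \sum_(M <= k < M + n) r k by apply: sumr_ge0.
  have := t_small (M + n)%N (leq_addr _ _).
  rewrite {2}/r; case: (ltP e (N (M + n)%N)) => ? ?; rewrite ?mul1r ?mul0r; lra.
exists M => // n /= Mn; rewrite sub0r normrN ger0_norm//.
have := main (n - M)%N; have := HM1 M n M1M; rewrite subnKC// /e; lra.
Qed.

End GradientToZero.

(** * Measurability and conditioning *)

Section ContinuousMeasurable.
Context (d : measure_display) (T : measurableType d) (R : realType) (m : nat).

(** An open set of row vectors is a countable union of boxes with rational centre and
    radius [1 / (k + 1)], and a box involves finitely many coordinates. *)
Lemma measurable_comp_rV (h : 'rV[R]_m -> R) (f : T -> 'rV[R]_m) :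
  continuous h -> (forall i, measurable_fun [set: T] (fun w => f w ord0 i)) ->
  measurable_fun [set: T] (h \o f).
Proof.
move=> ch mf; apply: (measurability _ (RGenOpens.measurableE R)).
move=> _ [_ [a [b ->] <-]]; rewrite setTI.
pose U := h @^-1` `]a, b[%classic.
have oU : open U by move/continuousP : ch; apply; exact: interval_open.
pose box (c : 'rV[rat]_m * nat) : set 'rV[R]_m :=
  [set v | forall i, `|ratr (c.1 ord0 i) - v ord0 i| < (c.2.+1%:R)^-1].
pose B (c : 'rV[rat]_m * nat) : set T :=
  if `[< box c `<=` U >] then f @^-1` box c else set0.
have -> : (h \o f) @^-1` `]a, b[ = \bigcup_c B c.
  apply/seteqP; split => [w /= fw|w [c _]]; last first.
    by rewrite /B; case: asboolP => //= + bw; apply.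
  have : nbhs (f w) U by apply: open_nbhs_nbhs; split.
  move=> /nbhs_ballP[e /= e0 eU].
  have [k ke] : exists k : nat, 2 * (k.+1%:R)^-1 < e.
    have [k /= _ /(_ _ (leqnn k))] := near_infty_natSinv_lt (PosNum (divr_gt0 e0 (ltr0n R 2))).
    by move=> /= ke; exists k; rewrite mulrC -ltr_pdivlMr.
  have k0 : 0 < (k.+1%:R)^-1 :> R by rewrite invr_gt0.
  have /choice[c Hc] : forall i : 'I_m, exists r : rat, `|ratr r - f w ord0 i| < (k.+1%:R)^-1.
    move: k0; set t := (k.+1%:R)^-1 => k0 i; have lt : f w ord0 i - t < f w ord0 i + t by lra.
    have [r] := rat_in_itvoo lt; rewrite in_itv/= => /andP[r1 r2].
    by exists r; rewrite ltr_norml; lra.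
  exists (\row_i c i, k) => //.
  have bw : box (\row_i c i, k) (f w) by move=> i /=; rewrite mxE.
  rewrite /B; case: asboolP => // nb; exfalso; apply: nb => v bv; apply: eU.
  rewrite -ball_normE /= /ball_ /= /Num.Def.normr /= mx_normrE.
  apply/bigmax_ltP; split => // -[j i] _ /=.
  rewrite ord1 !mxE; have /= := bw i; have /= := bv i; rewrite mxE.
  move: ke; set t := (k.+1%:R)^-1; rewrite !ltr_norml; lra.
apply: countable_bigcupT_measurable => // c.
rewrite /B; case: asboolP => // _.
have -> : f @^-1` box c = \bigcap_(i in [set: 'I_m])
    ((fun w => f w ord0 i) @^-1` ball (ratr (c.1 ord0 i) : R) (c.2.+1%:R)^-1).
  by apply/seteqP; split => w /= H i; [move=> _|have /(_ I) := H i]; rewrite -ball_normE /=; [exact: H|].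
apply: fin_bigcap_measurable => // i _; rewrite -[X in measurable X]setTI.
by apply: mf => //; exact: measurable_ball.
Qed.

End ContinuousMeasurable.

Section SubSigmaAlgebra.
Context (d : measure_display) (T : measurableType d).

Lemma measurable_wrt_sub d' (U : measurableType d') (F : set (set T)) (f : T -> U) :
  sigma_algebra [set: T] F -> F `<=` measurable ->
  measurable_wrt F f -> measurable_fun [set: T] f.
Proof.
move=> sF Fm mf _ A mA; apply: Fm.
by rewrite -(sigma_algebra_id sF); exact: mf.
Qed.

Lemma measurable_wrtS d' (U : measurableType d') (F F' : set (set T)) (f : T -> U) :
  F `<=` F' -> measurable_wrt F f -> measurable_wrt F' f.
Proof.
move=> FF' mf _ A mA; apply: (sub_sigma_algebra2 FF').
exact: mf.
Qed.

End SubSigmaAlgebra.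

Section PullOut.
Context (d : measure_display) (T : measurableType d) (R : realType).
Variables (P : {measure set T -> \bar R}) (F : set (set T)).
Hypothesis sF : sigma_algebra [set: T] F.
Hypothesis Fm : F `<=` measurable.
Local Open Scope ereal_scope.
Import HBNNSimple.

Let mF (A : set (g_sigma_algebraType F)) : measurable A -> F A.
Proof. by move=> mA; rewrite -(sigma_algebra_id sF). Qed.

Let integral_simple (h : {nnsfun g_sigma_algebraType F >-> R}) (X : T -> \bar R) :
  measurable_fun [set: T] X -> (forall w, 0 <= X w) ->
  \int[P]_w ((h w)%:E * X w) =
  \sum_(y \in range h) (y%:E * \int[P]_(w in h @^-1` [set y]) X w).
Proof.
move=> mX X0.
have mh y : d.-measurable (h @^-1` [set y] : set T) by apply: Fm; apply: mF.
have ind0 y w : 0 <= (y * \1_(h @^-1` [set y]) w)%:E.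
  exact: nnfun_muleindic_ge0.
transitivity (\int[P]_w (\sum_(y \in range h) (y * \1_(h @^-1` [set y] : set T) w)%:E * X w)).
  apply: eq_integral => w _.
  by rewrite -ge0_mule_fsuml => [|y]; [rewrite fsumEFin // -(fimfunE h)|exact: ind0].
rewrite ge0_integral_fsum//; last 2 first.
- move=> y; apply: emeasurable_funM => //; apply/measurable_EFinP.
  by apply: measurable_funM => //; exact: measurable_indic.
- by move=> y w _; rewrite mule_ge0// ind0.
apply: eq_fsbigr => y /[!inE] -[w0 _ hy].
rewrite (integral_mkcond (h @^-1` [set y] : set T)) -ge0_integralZl//.
- apply: eq_integral => w _; rewrite patchE indicE.
  by case: ifP => _; rewrite ?mulr1 ?mulr0 ?mul0e ?mule0.
- by apply/(measurable_restrictT _ (mh y)).1; exact: measurable_funTS.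
- by move=> w _; apply: erestrict_ge0.
- by rewrite lee_fin -hy.
Qed.

(** An inequality between integrals over the sets of [F] is an inequality between the
    integrals against simple [F]-measurable weights, and passes to increasing limits. *)
Lemma le_integral_pull_out (H : T -> R) (X1 X2 : T -> R) :
  (forall w, (0 <= H w)%R) -> measurable_wrt F H ->
  measurable_fun [set: T] X1 -> (forall w, (0 <= X1 w)%R) ->
  measurable_fun [set: T] X2 -> (forall w, (0 <= X2 w)%R) ->
  (forall A, F A -> \int[P]_(w in A) (X1 w)%:E <= \int[P]_(w in A) (X2 w)%:E) ->
  \int[P]_w (H w * X1 w)%:E <= \int[P]_w (H w * X2 w)%:E.
Proof.
move=> H0 mH mX1 X10 mX2 X20 X12.
pose H' : g_sigma_algebraType F -> \bar R := EFin \o H.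
have mH' : measurable_fun setT H' by apply/measurable_EFinP.
have H'0 x : [set: g_sigma_algebraType F] x -> 0 <= H' x by rewrite lee_fin.
pose h := nnsfun_approx measurableT mH'.
have lim (X : T -> R) : measurable_fun [set: T] X -> (forall w, 0 <= X w)%R ->
    \int[P]_w (H w * X w)%:E = limn (fun n => \int[P]_w ((h n w)%:E * (X w)%:E)) /\
    {homo (fun n => \int[P]_w ((h n w)%:E * (X w)%:E)) : n k / (n <= k)%N >-> n <= k}.
  move=> /measurable_EFinP mX X0.
  have mhX n : measurable_fun [set: T] (fun w => (h n w)%:E * (X w)%:E).
    apply: emeasurable_funM => //; apply/measurable_EFinP.
    by apply: (measurable_wrt_sub sF Fm); exact: measurable_funP.
  have hX0 n w : [set: T] w -> 0 <= (h n w)%:E * (X w)%:E by rewrite mule_ge0 ?lee_fin.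
  have hnd w : [set: T] w -> {homo (fun n => (h n w)%:E * (X w)%:E) : n k / (n <= k)%N >-> n <= k}.
    move=> _ n k nk; rewrite lee_wpmul2r ?lee_fin//.
    by have /lefP := nd_nnsfun_approx measurableT mH' nk; apply.
  split; last by move=> n k nk; apply: ge0_le_integral => // w ?; [exact: hX0|exact: hnd].
  rewrite -monotone_convergence//; apply: eq_integral => w _.
  rewrite EFinM; apply/esym/cvg_lim => //; apply: cvgeZr => //.
  exact: (cvg_nnsfun_approx measurableT mH' H'0).
have [-> nd1] := lim _ mX1 X10; have [-> nd2] := lim _ mX2 X20.
apply: lee_lim; [exact: ereal_nondecreasing_is_cvgn|exact: ereal_nondecreasing_is_cvgn|].
apply: nearW => n; rewrite !integral_simple//; try exact/measurable_EFinP.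
apply: lee_fsum => // y [w _ <-]; apply: lee_wpmul2l; first by rewrite lee_fin.
by apply: X12; apply: mF.
Qed.

End PullOut.

(** * Supermartingale convergence *)

Local Notation Rintegrable P f := (P.-integrable [set: _] (EFin \o f)).

Section BoundedVariables.
Context (T : Type) (R : realType).
Implicit Types f g : T -> R.

Definition bounded_rv f := exists M, forall w, `|f w| <= M.

Lemma bounded_rvP f (M : R) : (forall w, 0 <= f w) -> (forall w, f w <= M) -> bounded_rv f.
Proof. by move=> f0 fM; exists M => w; rewrite ger0_norm. Qed.

Lemma bounded_rv_cst (c : R) : bounded_rv (fun _ : T => c).
Proof. by exists `|c|. Qed.

Lemma bounded_rvD f g : bounded_rv f -> bounded_rv g -> bounded_rv (fun w => f w + g w).
Proof.
move=> [M fM] [N gN]; exists (M + N) => w.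
by rewrite (le_trans (ler_normD _ _))// lerD.
Qed.

Lemma bounded_rvM f g : bounded_rv f -> bounded_rv g -> bounded_rv (fun w => f w * g w).
Proof.
move=> [M fM] [N gN]; exists (M * N) => w.
by rewrite normrM ler_pM.
Qed.

Lemma bounded_rvX f n : bounded_rv f -> bounded_rv (fun w => f w ^+ n).
Proof. by move=> [M fM]; exists (M ^+ n) => w; rewrite normrX lerXn2r ?nnegrE// (le_trans _ (fM w)). Qed.

End BoundedVariables.

Section Expectation.
Context (d : measure_display) (T : measurableType d) (R : realType).
Variable P : probability T R.
Implicit Types f g : T -> R.

Lemma eq_Rintegrable f g : f =1 g -> Rintegrable P f -> Rintegrable P g.
Proof. by move=> /funext->. Qed.

Lemma RintegrableD f g : Rintegrable P f -> Rintegrable P g -> Rintegrable P (fun w => f w + g w).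
Proof. by move=> fi gi; apply: eq_integrable (integrableD _ fi gi). Qed.

Lemma RintegrableB f g : Rintegrable P f -> Rintegrable P g -> Rintegrable P (fun w => f w - g w).
Proof. by move=> fi gi; apply: eq_integrable (integrableB _ fi gi). Qed.

Lemma RintegrableZ (c : R) f : Rintegrable P f -> Rintegrable P (fun w => c * f w).
Proof. by move=> fi; apply: eq_integrable (integrableZl _ c fi). Qed.

Lemma Rintegrable_bounded f : measurable_fun [set: T] f -> bounded_rv f -> Rintegrable P f.
Proof.
move=> mf [M fM]; apply: measurable_bounded_integrable => //.
  exact: fin_num_fun_lty.
by exists M; split; [exact: num_real|move=> y My w _; exact: le_trans (fM w) (ltW My)].
Qed.

Lemma RintegrableM_bounded f g : measurable_fun [set: T] f -> bounded_rv f ->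
  Rintegrable P g -> Rintegrable P (fun w => f w * g w).
Proof.
move=> mf [M fM] gi; apply: eq_integrable (integrableMr _ mf _ gi) => //.
by exists M; split; [exact: num_real|move=> y My w _; exact: le_trans (fM w) (ltW My)].
Qed.

Lemma Rintegrable_sum (I : Type) (r : seq I) (f : I -> T -> R) :
  (forall k, Rintegrable P (f k)) -> Rintegrable P (fun w => \sum_(k <- r) f k w).
Proof.
move=> fi; elim: r => [|k r IH].
  apply: (@eq_Rintegrable (cst 0)); first by move=> w; rewrite big_nil.
  by apply: Rintegrable_bounded => //; exists 0 => w; rewrite normr0.
by apply: eq_Rintegrable (RintegrableD (fi k) IH) => w; rewrite big_cons.
Qed.

Lemma Rintegral_sum (I : Type) (r : seq I) (f : I -> T -> R) :
  (forall k, Rintegrable P (f k)) ->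
  \int[P]_w (\sum_(k <- r) f k w) = \sum_(k <- r) \int[P]_w f k w.
Proof.
move=> fi; elim: r => [|k r IH].
  rewrite big_nil -[RHS](mul0r (fine (P [set: T]))) -(Rintegral_cst P)//.
  by apply: eq_Rintegral => w _; rewrite big_nil.
rewrite big_cons -IH -RintegralD//; last exact: Rintegrable_sum.
by apply: eq_Rintegral => w _; rewrite big_cons.
Qed.

Lemma EFin_Rintegral f : Rintegrable P f -> (\int[P]_w f w)%:E = (\int[P]_w (f w)%:E)%E.
Proof. by move=> fi; rewrite fineK//; exact: integrable_fin_num. Qed.

Lemma Rintegral_bool (C : T -> bool) f :
  \int[P]_w ((C w)%:R * f w) = \int[P]_(w in [set w | C w]) f w.
Proof.
rewrite [RHS]Rintegral_mkcond; apply: eq_Rintegral => w _; rewrite patchE.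
case: (boolP (C w)) => Cw; rewrite ?mul1r ?mul0r; first by rewrite mem_set.
by rewrite memNset// => /=; rewrite (negbTE Cw).
Qed.

(** By monotone convergence the sum of the series has finite expectation, so it is almost
    surely finite. *)
Lemma ae_bounded_sums (f : nat -> T -> R) : (forall k, Rintegrable P (f k)) ->
  (forall k w, 0 <= f k w) -> bounded_sums (fun k => \int[P]_w f k w) ->
  {ae P, forall w, bounded_sums (f^~ w)}.
Proof.
move=> fi f0 [M fM].
have mf k : measurable_fun [set: T] (fun w => (f k w)%:E) by exact: (measurable_int _ (fi k)).
have f0' k w : [set: T] w -> (0 <= (f k w)%:E)%E by rewrite lee_fin.
have : P.-integrable [set: T] (fun w => \sum_(0 <= k <oo) (f k w)%:E)%E.
  apply/integrableP; split.
    by apply: ge0_emeasurable_sum => [k w tw _|k _]; [exact: f0'|exact: mf].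
  rewrite (eq_integral (fun w => \sum_(0 <= k <oo) (f k w)%:E)%E); last first.
    by move=> w _; rewrite gee0_abs//; apply: nneseries_ge0 => k _ _; exact: f0'.
  rewrite integral_nneseries//; apply: (@le_lt_trans _ _ M%:E); last by rewrite ltry.
  apply: lime_le.
    by apply: is_cvg_nneseries => k _ _; apply: integral_ge0 => w; exact: f0'.
  apply: nearW => n; rewrite (le_trans _ (_ : (\sum_(0 <= k < n) \int[P]_w f k w)%R%:E <= _)%E)//.
    by rewrite -sumEFin; apply: lee_sum => k _; rewrite EFin_Rintegral.
  by rewrite lee_fin.
move=> /(integrable_ae measurableT); apply: filterS => w /(_ I) fw.
exists (fine (\sum_(0 <= k <oo) (f k w)%:E)%E) => n.
rewrite -lee_fin fineK// -sumEFin; apply: nneseries_lim_ge => k _ _; exact: f0'.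
Qed.

End Expectation.

Section Supermartingale.
Context (d : measure_display) (T : measurableType d) (R : realType).
Variables (P : probability T R) (F : nat -> set (set T)) (U : nat -> T -> R).
Hypothesis filtF : filtration F.
Hypothesis U_ge0 : forall n w, 0 <= U n w.
Hypothesis mU : forall n, measurable_wrt (F n) (U n).
Hypothesis iU : forall n, Rintegrable P (U n).
Hypothesis superU : forall n A, F n A ->
  \int[P]_(w in A) U n.+1 w <= \int[P]_(w in A) U n w.

Let sF n : sigma_algebra [set: T] (F n). Proof. by case: filtF. Qed.
Let Fm n : F n `<=` measurable. Proof. by case: filtF. Qed.

Lemma measurable_holding a b n :
  measurable_wrt (F n) (fun w => holding (U^~ w) a b n).
Proof.
have mlt k : measurable_wrt (F k) (fun w => U k w < a).
  apply: (@measurable_fun_ltr _ (g_sigma_algebraType (F k)) R setT (U k) (cst a)).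
    exact: mU.
  exact: measurable_cst.
have mle k : measurable_wrt (F k) (fun w => U k w <= b).
  apply: (@measurable_fun_ler _ (g_sigma_algebraType (F k)) R setT (U k) (cst b)).
    exact: mU.
  exact: measurable_cst.
elim: n => [|n IH] /=; first exact: mlt.
have sub : F n `<=` F n.+1 by case: filtF => _ _; apply.
apply: measurable_fun_if => //; first exact: measurable_wrtS sub IH.
  by apply: measurable_funTS; exact: mle.
by apply: measurable_funTS; exact: mlt.
Qed.

Let measurable_indicator (C : T -> bool) : measurable_fun [set: T] C ->
  measurable_fun [set: T] (fun w => (C w)%:R : R).
Proof.
move=> mC; have -> : (fun w => (C w)%:R : R) = (fun w => if C w then 1 else 0).
  by apply/funext => w; case: (C w).
by apply: measurable_fun_if => //; exact: measurable_cst.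
Qed.

Let bounded_bool (C : T -> bool) : bounded_rv (fun w => (C w)%:R : R).
Proof. by exists 1 => w; case: (C w); rewrite ?normr1 ?normr0. Qed.

Let measurable_holdingT a b n : measurable_fun [set: T] (fun w => holding (U^~ w) a b n).
Proof. by apply: (@measurable_wrt_sub _ T _ _ (F n)) => //; exact: measurable_holding. Qed.

Let measurable_sale a b n : measurable_fun [set: T] (fun w => (sale (U^~ w) a b n)%:R : R).
Proof. by apply: measurable_indicator; apply: measurable_and => //; exact: measurable_neg. Qed.

Lemma expected_gain_le0 a b n :
  \int[P]_w ((holding (U^~ w) a b n)%:R * (U n.+1 w - U n w)) <= 0.
Proof.
set A := [set w | holding (U^~ w) a b n].
have FA : F n A.
  rewrite -(sigma_algebra_id (sF n)).
  have := measurable_holding a b (n:=n) measurableT (Y := [set true]).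
  by rewrite setTI; apply.
rewrite Rintegral_bool RintegralB; last 3 first.
- exact: Fm FA.
- by apply: integrableS (iU _) => //; exact: Fm FA.
- by apply: integrableS (iU _) => //; exact: Fm FA.
by rewrite subr_le0; exact: superU.
Qed.

(** The expected gain of the strategy is nonpositive, while each sale earns [b - a]. *)
Lemma sum_sales_bounded (a b : R) : a < b ->
  {ae P, forall w, bounded_sums (fun n => (sale (U^~ w) a b n)%:R : R)}.
Proof.
move=> ab; apply: ae_bounded_sums => [k|k w|].
- exact: Rintegrable_bounded (measurable_sale a b k) (bounded_bool _).
- exact: ler0n.
exists (`|a| / (b - a)) => n; rewrite ler_pdivlMr ?subr_gt0// mulrC.
have sale_int k : Rintegrable P (fun w => (sale (U^~ w) a b k)%:R).
  exact: Rintegrable_bounded (measurable_sale a b k) (bounded_bool _).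
have gain_int k : Rintegrable P (fun w => (holding (U^~ w) a b k)%:R * (U k.+1 w - U k w)).
  apply: RintegrableM_bounded; [exact/measurable_indicator/measurable_holdingT|exact: bounded_bool|].
  exact: RintegrableB.
have cst_int : Rintegrable P (fun _ => `|a|).
  by apply: Rintegrable_bounded => //; exists `|a| => w; rewrite normr_id.
rewrite -Rintegral_sum// -RintegralZl//; last exact: Rintegrable_sum.
apply: (@le_trans _ _ (\int[P]_w (\sum_(0 <= k < n)
    (holding (U^~ w) a b k)%:R * (U k.+1 w - U k w) + `|a|))).
  apply: le_Rintegral => //.
  - by apply: RintegrableZ; exact: Rintegrable_sum.
  - by apply: RintegrableD => //; exact: Rintegrable_sum.
  move=> w _; have := gain_ge_sales (U^~ w) a b n.
  have := U_ge0 n w; have := ler_norm a; have := normr_ge0 a.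
  by case: (holding _ _ _ n); rewrite ?mul1r ?mul0r; lra.
rewrite RintegralD//; last exact: Rintegrable_sum.
rewrite Rintegral_sum// Rintegral_cst// [fine _](congr1 fine (probability_setT P))/= mulr1 gerDr.
by apply: sumr_le0 => k _; exact: expected_gain_le0.
Qed.

Lemma expectation_decreasing n : \int[P]_w U n w <= \int[P]_w U 0%N w.
Proof.
elim: n => // n; apply: le_trans; apply: superU.
by rewrite -(sigma_algebra_id (sF n)); exact: (@measurableT _ (g_sigma_algebraType (F n))).
Qed.

(** By Fatou, [liminf U_n] has finite expectation; it would be infinite on the event that
    [U n] exceeds every level eventually. *)
Lemma not_diverging :
  {ae P, forall w, exists K, ~ exists M, forall n, (M <= n)%N -> K <= U n w}.
Proof.
have mU' n : measurable_fun [set: T] (fun w => (U n w)%:E) by exact: (measurable_int _ (iU n)).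
have U0 n w : [set: T] w -> (0 <= (U n w)%:E)%E by rewrite lee_fin.
have inf0 w : (0 <= limn_einf (fun n => (U n w)%:E))%E.
  rewrite limn_einf_lim; apply: lime_ge; first exact: is_cvg_einfs.
  by apply: nearW => n; apply: le_ereal_inf_tmp => _ [k _ <-]; exact: U0.
have : P.-integrable [set: T] (fun w => limn_einf (fun n => (U n w)%:E)).
  apply/integrableP; split.
    have -> : (fun w => limn_einf (fun n => (U n w)%:E)) =
              (fun w => - limn_esup (-%E \o (fun n => (U n w)%:E)))%E.
      by apply/funext => w; rewrite limn_esupN oppeK.
    apply: measurableT_comp => //; apply: measurable_fun_limn_esup => n.
    exact: measurableT_comp.
  under eq_integral do rewrite gee0_abs//.
  apply: (le_lt_trans (fatou P measurableT mU' U0)).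
  apply: (@le_lt_trans _ _ (\int[P]_w U 0%N w)%:E); last by rewrite ltry.
  rewrite (le_trans (limn_einf_sup _))// limn_esup_lim; apply: lime_le; first exact: is_cvg_esups.
  apply: nearW => n; apply: ge_ereal_sup => _ [k _ <-].
  by rewrite -EFin_Rintegral// lee_fin; exact: expectation_decreasing.
move=> /(integrable_ae measurableT); apply: filterS => w /(_ I) fw.
apply: contrapT => nK; move: fw.
have : (U n w)%:E @[n --> \oo] --> +oo%E.
  apply/cvgeryP/cvgryPge => K.
  apply: contrapT => nKw; apply: nK; exists K => -[M HM]; apply: nKw.
  by exists M => // n /=; exact: HM.
by move=> U_oo; rewrite is_cvg_limn_einfE; [rewrite (cvg_lim _ U_oo)|apply/cvg_ex; exists +oo%E].
Qed.

(** Doob: almost surely no interval with rational endpoints is crossed infinitely often. *)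
Theorem supermartingale_cvg : {ae P, forall w, cvgn (U^~ w)}.
Proof.
have H : {ae P, forall w, forall k (rs : rat * rat), unpickle k = Some rs ->
    ratr rs.1 < ratr rs.2 :> R ->
    bounded_sums (fun n => (sale (U^~ w) (ratr rs.1) (ratr rs.2) n)%:R : R)}.
  apply: ae_foralln => k; case: (unpickle k) => [rs|]; last exact: aeW.
  have [lt|ge] := ltP (ratr rs.1 : R) (ratr rs.2).
    by apply: filterS (sum_sales_bounded lt) => w Hw _ [<-].
  by apply: aeW => w _ [<-]; rewrite ltNge ge.
apply: filterS2 H not_diverging => w H [K HK].
have cr (a b : R) : a < b ->
    (exists M, forall n, (M <= n)%N -> U n w <= b) \/
    (exists M, forall n, (M <= n)%N -> a <= U n w).
  move=> /has_rat_between[r [s [ar rs sb]]].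
  have [[M HM]|[M HM]] := no_crossing (H _ (r, s) (pickleK _) rs); [left|right].
    by exists M => n /HM/le_trans; apply.
  by exists M => n /HM; exact: le_trans.
apply: (@no_crossing_cvg _ _ 0) => //.
have K1 : K < K + 1 by rewrite ltrDl.
by have [above|/HK] := cr _ _ K1; [exists (K + 1)|].
Qed.

End Supermartingale.

(** * Conditional expectation against bounded weights *)

Section RealPullOut.
Context (d : measure_display) (T : measurableType d) (R : realType).
Variables (P : probability T R) (F : set (set T)).
Hypothesis sF : sigma_algebra [set: T] F.
Hypothesis Fm : F `<=` measurable.
Implicit Types H X Y : T -> R.

Lemma le_Rintegral_pull_out H X Y :
  (forall w, 0 <= H w) -> measurable_wrt F H -> bounded_rv H ->
  (forall w, 0 <= X w) -> Rintegrable P X -> (forall w, 0 <= Y w) -> Rintegrable P Y ->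
  (forall A, F A -> \int[P]_(w in A) (X w)%:E <= \int[P]_(w in A) (Y w)%:E)%E ->
  \int[P]_w (H w * X w) <= \int[P]_w (H w * Y w).
Proof.
move=> H0 mH bH X0 iX Y0 iY XY.
have mH' := measurable_wrt_sub sF Fm mH.
rewrite -lee_fin !EFin_Rintegral; [|exact: RintegrableM_bounded..].
apply: (le_integral_pull_out sF Fm) => //.
- exact/measurable_EFinP/(measurable_int _ iX).
- exact/measurable_EFinP/(measurable_int _ iY).
Qed.

(** Adding [|X| + |Y|] to both variables and a constant to [H] makes everything
    nonnegative. *)
Lemma Rintegral_pull_out H X Y : measurable_wrt F H -> bounded_rv H ->
  Rintegrable P X -> Rintegrable P Y ->
  (forall A, F A -> \int[P]_(w in A) (X w)%:E = \int[P]_(w in A) (Y w)%:E)%E ->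
  \int[P]_w (H w * X w) = \int[P]_w (H w * Y w).
Proof.
move=> mH bH iX iY XY; have [M HM] := bH.
have mH' := measurable_wrt_sub sF Fm mH.
pose Z w := `|X w| + `|Y w|; pose K w := H w + M.
have iZ : Rintegrable P Z by apply: RintegrableD; apply: integrable_norm.
have mK : measurable_wrt F K.
  by apply: (@measurable_funD _ (g_sigma_algebraType F)); [exact: mH|exact: measurable_cst].
have bK : bounded_rv K by apply: bounded_rvD => //; exact: bounded_rv_cst.
have K0 w : 0 <= K w by rewrite /K; have := HM w; rewrite ler_norml; lra.
have XZ0 w : 0 <= X w + Z w by rewrite /Z; have := ler_norm (- X w); rewrite normrN; have := normr_ge0 (Y w); lra.
have YZ0 w : 0 <= Y w + Z w by rewrite /Z; have := ler_norm (- Y w); rewrite normrN; have := normr_ge0 (X w); lra.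
have iXZ : Rintegrable P (fun w => X w + Z w) by exact: RintegrableD.
have iYZ : Rintegrable P (fun w => Y w + Z w) by exact: RintegrableD.
have XYZ A : F A -> (\int[P]_(w in A) (X w + Z w)%:E = \int[P]_(w in A) (Y w + Z w)%:E)%E.
  move=> FA; have mA := Fm FA.
  under eq_integral do rewrite EFinD; under [RHS]eq_integral do rewrite EFinD.
  have iA V : Rintegrable P V -> P.-integrable A (EFin \o V).
    by apply: integrableS.
  by rewrite !integralD ?XY//; apply: iA.
have E : \int[P]_w (K w * (X w + Z w)) = \int[P]_w (K w * (Y w + Z w)).
  apply/eqP; rewrite eq_le; apply/andP; split; apply: le_Rintegral_pull_out => // A FA; by rewrite XYZ.
have iH V : Rintegrable P V -> Rintegrable P (fun w => H w * V w).
  exact: RintegrableM_bounded.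
have split_K V : Rintegrable P V -> \int[P]_w (K w * (V w + Z w)) =
    \int[P]_w (H w * V w) + M * \int[P]_w V w + \int[P]_w (K w * Z w).
  move=> iV; have iHV := iH _ iV; have iMV := RintegrableZ M iV.
  have iKZ : Rintegrable P (fun w => K w * Z w).
    by apply: RintegrableM_bounded => //; exact: (measurable_wrt_sub sF Fm).
  have iHMV := RintegrableD iHV iMV.
  rewrite -RintegralZl// -!RintegralD//.
  by apply: eq_Rintegral => w _; rewrite /K; ring.
move: E; rewrite !split_K//.
have -> : \int[P]_w X w = \int[P]_w Y w.
  rewrite /Rintegral XY//; rewrite -(sigma_algebra_id sF).
  exact: (@measurableT _ (g_sigma_algebraType F)).
by move=> /addIr/addIr.
Qed.

End RealPullOut.

(** * Convergence of the algorithm *)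

Section AdaGrad.
Context (d : measure_display) (T : measurableType d) (R : realType)
  (P : probability T R) (F : nat -> set (set T)) (m : nat)
  (g : 'rV[R]_m -> R) (L q alpha S0 beta sigma : R) (theta0 : 'rV[R]_m)
  (theta G : nat -> T -> 'rV[R]_m) (S : nat -> T -> R)
  (EG : nat -> T -> 'rV[R]_m) (EG2 : nat -> T -> \bar R).
Hypothesis filtF : filtration F.
Hypothesis g_ge0 : forall x, 0 <= g x.
Hypothesis g_C1 : continuously_differentiable g.
Hypothesis L_ge0 : 0 <= L.
Hypothesis lipg : forall x y, enorm (grad g x - grad g y) <= L * enorm (x - y).
Hypothesis q_gt : 1 / 2 < q.
Hypothesis S0_gt0 : 0 < S0.
Hypothesis alpha_gt0 : 0 < alpha.
Hypothesis beta_ge0 : 0 <= beta.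
Hypothesis theta_meas : forall n, vec_measurable_wrt (F n) (theta n).
Hypothesis S_meas : forall n, measurable_wrt (F n) (S n).
Hypothesis G_meas : forall n, vec_measurable_wrt (F n.+1) (G n).
Hypothesis theta_init : forall w, theta 0%N w = theta0.
Hypothesis S_init : forall w, S 0%N w = S0.
Hypothesis S_rec : forall n w, S n.+1 w = S n w + enorm (G n w) ^+ 2.
Hypothesis theta_rec : forall n w,
  theta n.+1 w = theta n w - (alpha * S n.+1 w `^ (- q)) *: G n w.
Hypothesis EG_version : forall n, vec_cond_exp_version P (F n) (G n) (EG n).
Hypothesis EG2_version : forall n,
  cond_exp_version P (F n) (fun w => (enorm (G n w) ^+ 2)%:E) (EG2 n).
Hypothesis unbiased : forall n, {ae P, forall w, EG n w = grad g (theta n w)}.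
Hypothesis second_moment : forall n, {ae P, forall w,
  (EG2 n w <= (beta * enorm (grad g (theta n w)) ^+ 2 + sigma ^+ 2)%:E)%E}.

Let sF n : sigma_algebra [set: T] (F n). Proof. by case: filtF. Qed.
Let Fm n : F n `<=` measurable. Proof. by case: filtF. Qed.
Let FT n : F n [set: T].
Proof.
by rewrite -(sigma_algebra_id (sF n)); exact: (@measurableT _ (g_sigma_algebraType (F n))).
Qed.

Let N n w := enorm (grad g (theta n w)).
Let gam n w := enorm (G n w).
Let x n w := S n w `^ (- q).
Let p n w := dotr (grad g (theta n w)) (G n w).
Let c n w := beta * N n w ^+ 2 + sigma ^+ 2.

Let N_ge0 n w : 0 <= N n w. Proof. exact: enorm_ge0. Qed.
Let gam_ge0 n w : 0 <= gam n w. Proof. exact: enorm_ge0. Qed.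
Let x_ge0 n w : 0 <= x n w. Proof. exact: powR_ge0. Qed.
Let c_ge0 n w : 0 <= c n w.
Proof. by apply: addr_ge0; [apply: mulr_ge0 => //|]; exact: sqr_ge0. Qed.

Let S_nd w n k : (n <= k)%N -> S n w <= S k w.
Proof.
move/subnKC <-; elim: (k - n)%N => [|i IH]; first by rewrite addn0.
by rewrite addnS S_rec (le_trans IH)// lerDl sqr_ge0.
Qed.

Let S_ge n w : S0 <= S n w.
Proof. by rewrite -(S_init w); exact: S_nd. Qed.

Let S_gt0 n w : 0 < S n w.
Proof. exact: lt_le_trans (S_ge n w). Qed.

Let q_ge0 : 0 <= q. Proof. by move: q_gt; lra. Qed.
Let r_gt0 : 0 < 2 * q - 1. Proof. by move: q_gt; lra. Qed.

Let x_nd n w : x n.+1 w <= x n w.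
Proof. by apply: power_decreasing => //; exact: S_nd. Qed.

Let x_le n w : x n w <= S0 `^ (- q).
Proof. by apply: power_decreasing => //; exact: S_ge. Qed.

(** [|G_n|^2] is the increment of [S], so the squared steps telescope. *)
Let step_sqr n w : (x n.+1 w * gam n w) ^+ 2 <=
  (S n w `^ (1 - 2 * q) - S n.+1 w `^ (1 - 2 * q)) / (2 * q - 1).
Proof.
have := power_increment (S_gt0 n w) (S_nd w (leqnSn n)) q_gt.
by rewrite {1}S_rec addrC addKr exprMn mulrC.
Qed.

Let powr_le n w : S n w `^ (1 - 2 * q) <= S0 `^ (1 - 2 * q).
Proof.
rewrite -[1 - 2 * q]opprK; apply: power_decreasing => //.
by move: r_gt0; lra.
Qed.

Let D := 1 + S0 `^ (1 - 2 * q) / (2 * q - 1).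

Let step_le n w : x n.+1 w * gam n w <= D.
Proof.
have H : (x n.+1 w * gam n w) ^+ 2 <= S0 `^ (1 - 2 * q) / (2 * q - 1).
  apply: (le_trans (step_sqr n w)); rewrite ler_pM2r ?invr_gt0//.
  by have := powr_le n w; have := powR_ge0 (S n.+1 w) (1 - 2 * q); lra.
rewrite /D; move: H; set e := _ * gam _ _; set h := _ / _ => H.
have := sqr_ge0 (e - 1); have := sqr_ge0 e; nra.
Qed.

Let theta_incr n w : theta n.+1 w - theta n w = - ((alpha * x n.+1 w) *: G n w).
Proof. by rewrite theta_rec addrAC subrr add0r. Qed.

Let N_rec n w : N n.+1 w <= N n w + L * (alpha * x n.+1 w * gam n w).
Proof.
rewrite /N -{1}(subrK (grad g (theta n w)) (grad g (theta n.+1 w))) addrC.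
rewrite (le_trans (ler_enormD _ _))// lerD2l (le_trans (lipg _ _))//.
rewrite theta_incr enormN enormZ ger0_norm//.
by rewrite mulr_ge0// ltW.
Qed.

Let g_rec n w : g (theta n.+1 w) <= g (theta n w) - alpha * x n.+1 w * p n w +
  L / 2 * (alpha * x n.+1 w * gam n w) ^+ 2.
Proof.
have := descent (proj1 g_C1) lipg (theta n w) (- ((alpha * x n.+1 w) *: G n w)).
rewrite -theta_rec dotrN dotrZr enormN enormZ ger0_norm//.
by rewrite mulr_ge0// ltW.
Qed.

Let p_le n w : `|p n w| <= N n w * gam n w.
Proof.
rewrite ler_norml dotr_le_enorm andbT lerNl -dotrN.
by rewrite (le_trans (dotr_le_enorm _ _))// enormN.
Qed.

(** The steps being bounded by a constant, each iterate is a bounded random variable; this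
    gives all the integrability used below. *)
Let bounded_N n : bounded_rv (N n).
Proof.
elim: n => [|n [M HM]].
  by apply: (@bounded_rvP _ _ _ (enorm (grad g theta0))) => // w; rewrite /N theta_init.
apply: (@bounded_rvP _ _ _ (M + L * (alpha * D))) => // w.
rewrite (le_trans (N_rec n w))// lerD//; first exact: le_trans (ler_norm _) (HM w).
by rewrite ler_wpM2l// -mulrA ler_wpM2l ?step_le// ltW.
Qed.

Let bounded_g n : bounded_rv (fun w => g (theta n w)).
Proof.
elim: n => [|n [M HM]].
  by apply: (@bounded_rvP _ _ _ (g theta0)) => // w; rewrite theta_init.
have [K HK] := bounded_N n.
apply: (@bounded_rvP _ _ _ (M + alpha * (K * D) + L / 2 * (alpha * D) ^+ 2)) => // w.
have st := step_le n w; have st0 := mulr_ge0 (x_ge0 n.+1 w) (gam_ge0 n w).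
rewrite (le_trans (g_rec n w))// lerD//.
  rewrite lerD//; first exact: le_trans (ler_norm _) (HM w).
  rewrite -mulrN -mulrA ler_pM2l//.
  apply: (@le_trans _ _ (x n.+1 w * (N n w * gam n w))).
    by rewrite ler_wpM2l// lerNl; have := p_le n w; rewrite ler_norml => /andP[].
  rewrite mulrCA ler_pM//; exact: le_trans (ler_norm _) (HK w).
rewrite ler_wpM2l ?divr_ge0// -mulrA lerXn2r ?nnegrE ?mulr_ge0// ?(ltW alpha_gt0)//.
  exact: le_trans st.
by rewrite ler_pM2l.
Qed.

Let MT n := g_sigma_algebraType (F n).

Let measurable_g n : measurable_wrt (F n) (fun w => g (theta n w)).
Proof.
apply: (@measurable_comp_rV _ (MT n) _ _ g (theta n)); last exact: theta_meas.
by move=> v; apply: differentiable_continuous; exact: (proj1 g_C1).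
Qed.

Let measurable_grad n i : measurable_wrt (F n) (fun w => grad g (theta n w) ord0 i).
Proof.
apply: (@measurable_comp_rV _ (MT n) _ _ (fun v => grad g v ord0 i) (theta n)); last exact: theta_meas.
move=> v; apply: (@continuous_comp _ _ _ (grad g) (fun M : 'rV[R]_m => M ord0 i)).
  exact: (proj2 g_C1).
exact: coord_continuous.
Qed.

Let measurable_N2 n : measurable_wrt (F n) (fun w => N n w ^+ 2).
Proof.
rewrite (_ : (fun w => _) = (fun w => \sum_(i < m) grad g (theta n w) ord0 i * grad g (theta n w) ord0 i)).
  apply: (@measurable_sum _ (MT n)) => i; apply: (@measurable_funM _ (MT n)); exact: measurable_grad.
by apply/funext => w; rewrite /N enorm_sqr.
Qed.

Let measurable_G n i : measurable_fun [set: T] (fun w => G n w ord0 i).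
Proof. by apply: (@measurable_wrt_sub _ T _ _ (F n.+1)) => //; exact: G_meas. Qed.

Let measurable_gam2 n : measurable_fun [set: T] (fun w => gam n w ^+ 2).
Proof.
rewrite (_ : (fun w => _) = (fun w => \sum_(i < m) G n w ord0 i * G n w ord0 i)).
  by apply: measurable_sum => i; apply: measurable_funM; exact: measurable_G.
by apply/funext => w; rewrite /gam enorm_sqr.
Qed.

Let measurable_powS n r : measurable_wrt (F n) (fun w => S n w `^ r).
Proof.
apply: (@measurableT_comp _ _ _ (MT n) _ _ (@powR R ^~ r)); first exact: measurable_powR.
exact: S_meas.
Qed.

Let measurable_c n : measurable_wrt (F n) (c n).
Proof.
apply: (@measurable_funD _ (MT n)); last exact: measurable_cst.
by apply: (@measurable_funM _ (MT n)); [exact: measurable_cst|exact: measurable_N2].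
Qed.

Let bounded_c n : bounded_rv (c n).
Proof.
apply: bounded_rvD; last exact: bounded_rv_cst.
by apply: bounded_rvM; [exact: bounded_rv_cst|exact: bounded_rvX].
Qed.

Let bounded_x n : bounded_rv (x n).
Proof. by apply: (@bounded_rvP _ _ _ (S0 `^ (- q))). Qed.

Let integrable_c n : Rintegrable P (c n).
Proof.
by apply: Rintegrable_bounded => //; apply: (@measurable_wrt_sub _ T _ _ (F n)) => //; exact: measurable_c.
Qed.

(** The version [EG2 n] may take negative values on a null set, hence its positive part. *)
Let cond_second_moment n A : F n A ->
  (\int[P]_(w in A) (gam n w ^+ 2)%:E <= \int[P]_(w in A) (c n w)%:E)%E.
Proof.
move=> FA; have mA := Fm FA.
have [_ mE <-//] := EG2_version n.
have mE' : measurable_fun A (EG2 n).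
  by apply: measurable_funTS; apply: (@measurable_wrt_sub _ T _ _ (F n)).
rewrite integralE.
apply: (@le_trans _ _ (\int[P]_(w in A) (EG2 n)^\+ w)%E).
  by rewrite geeDl// oppe_le0 integral_ge0.
apply: ae_ge0_le_integral => //.
- exact: measurable_funepos.
- by move=> w _; rewrite lee_fin.
- by apply: measurable_funTS; exact: (measurable_int _ (integrable_c n)).
apply: filterS (second_moment n) => w H _.
by rewrite funeposE ge_max H lee_fin c_ge0.
Qed.

Let integrable_gam2 n : Rintegrable P (fun w => gam n w ^+ 2).
Proof.
apply/integrableP; split; first exact/measurable_EFinP.
under eq_integral do rewrite gee0_abs ?lee_fin ?sqr_ge0//.
apply: (le_lt_trans (cond_second_moment (FT n))).
by apply: integrable_lty => //; exact: integrable_c.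
Qed.

Let integrable_G n i : Rintegrable P (fun w => G n w ord0 i).
Proof.
have i1 : Rintegrable P (fun w => 1 + gam n w ^+ 2).
  by apply: RintegrableD => //; apply: Rintegrable_bounded => //; exact: bounded_rv_cst.
apply: le_integrable i1 => //; first by apply/measurable_EFinP; exact: measurable_G.
move=> w _; rewrite lee_fin/= [leRHS]ger0_norm ?addr_ge0 ?sqr_ge0//.
rewrite (le_trans (normr_coord_le _ _))//.
by rewrite -/(gam n w); have := sqr_ge0 (gam n w - 1); have := sqr_ge0 (gam n w); nra.
Qed.

Let bounded_grad n i : bounded_rv (fun w => grad g (theta n w) ord0 i).
Proof.
have [M HM] := bounded_N n; exists M => w.
by rewrite (le_trans (normr_coord_le _ _))// (le_trans _ (HM w))// ler_norm.
Qed.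

Let integrable_grad n i : Rintegrable P (fun w => grad g (theta n w) ord0 i).
Proof.
apply: Rintegrable_bounded => //; apply: (@measurable_wrt_sub _ T _ _ (F n)) => //; exact: measurable_grad.
Qed.

Let cond_mean n i A : F n A -> (\int[P]_(w in A) (G n w ord0 i)%:E =
  \int[P]_(w in A) (grad g (theta n w) ord0 i)%:E)%E.
Proof.
move=> FA; have mA := Fm FA.
have [_ mE <-//] := EG_version n i.
apply: ae_eq_integral => //.
- apply: measurable_funTS; exact: (@measurable_wrt_sub _ T _ _ (F n)).
- by apply: measurable_funTS; exact: (measurable_int _ (integrable_grad n i)).
by apply: filterS (unbiased n) => w -> _.
Qed.

Let expect_inner n (H : T -> R) : measurable_wrt (F n) H -> bounded_rv H ->
  Rintegrable P (fun w => H w * p n w) /\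
  \int[P]_w (H w * p n w) = \int[P]_w (H w * N n w ^+ 2).
Proof.
move=> mH bH.
have pE w : H w * p n w = \sum_(i < m) (H w * grad g (theta n w) ord0 i) * G n w ord0 i.
  by rewrite /p /dotr mulr_sumr; apply: eq_bigr => i _; rewrite mulrA.
have NE w : H w * N n w ^+ 2 =
    \sum_(i < m) (H w * grad g (theta n w) ord0 i) * grad g (theta n w) ord0 i.
  by rewrite /N enorm_sqr /dotr mulr_sumr; apply: eq_bigr => i _; rewrite mulrA.
have mHi i : measurable_wrt (F n) (fun w => H w * grad g (theta n w) ord0 i).
  by apply: (@measurable_funM _ (MT n)); [exact: mH|exact: measurable_grad].
have bHi i : bounded_rv (fun w => H w * grad g (theta n w) ord0 i).
  exact: bounded_rvM.
have mHi' i : measurable_fun [set: T] (fun w => H w * grad g (theta n w) ord0 i).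
  by apply: (@measurable_wrt_sub _ T _ _ (F n)).
have iG i : Rintegrable P (fun w => (H w * grad g (theta n w) ord0 i) * G n w ord0 i).
  exact: RintegrableM_bounded.
have iN i : Rintegrable P (fun w => (H w * grad g (theta n w) ord0 i) * grad g (theta n w) ord0 i).
  exact: RintegrableM_bounded.
split.
  by apply: (eq_Rintegrable (fun w => esym (pE w))); exact: Rintegrable_sum.
rewrite (eq_Rintegral _ (fun w _ => pE w)) (eq_Rintegral _ (fun w _ => NE w)).
rewrite !Rintegral_sum//; apply: eq_bigr => i _.
apply: (Rintegral_pull_out (sF n) (Fm (n:=n))) => // A.
exact: cond_mean.
Qed.

Let expect_gam2 n (H : T -> R) : (forall w, 0 <= H w) -> measurable_wrt (F n) H -> bounded_rv H ->
  Rintegrable P (fun w => H w * gam n w ^+ 2) /\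
  \int[P]_w (H w * gam n w ^+ 2) <= \int[P]_w (H w * c n w).
Proof.
move=> H0 mH bH; split.
  by apply: RintegrableM_bounded => //; apply: (@measurable_wrt_sub _ T _ _ (F n)).
apply: (le_Rintegral_pull_out (sF n) (Fm (n:=n))) => // [w|A].
  exact: sqr_ge0.
exact: cond_second_moment.
Qed.

(* Adding [1] keeps the denominator of [lam] positive when [beta] and [sigma] vanish. *)
Let s2 := sigma ^+ 2 + 1.
Let K := L * alpha ^+ 2 / 2 + alpha * beta *
  ((L * alpha) ^+ 2 * (4 * (beta + 1) * S0 `^ (- q)) + (L * alpha) ^+ 2 * S0 `^ (- q)).
(** The energy. The term in [beta] absorbs the part of the noise that grows with the
    gradient, the last two terms the part that is summable along every path. *)
Let U n w := g (theta n w) + alpha * beta * (x n w * N n w ^+ 2) + alpha * s2 * x n w +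
  K / (2 * q - 1) * S n w `^ (1 - 2 * q).
Let lam n w := N n w ^+ 2 / (4 * (beta * N n w ^+ 2 + s2)).

Let s2_gt0 : 0 < s2. Proof. by rewrite ltr_wpDl// sqr_ge0. Qed.

Let K_ge0 : 0 <= K.
Proof.
have a0 := ltW alpha_gt0; have x0 := powR_ge0 S0 (- q).
rewrite /K addr_ge0 ?divr_ge0 ?(mulr_ge0 L_ge0) ?sqr_ge0// mulr_ge0 ?(mulr_ge0 a0)//.
by rewrite addr_ge0// mulr_ge0 ?sqr_ge0// !mulr_ge0// addr_ge0.
Qed.

Let lam_den n w : 0 < beta * N n w ^+ 2 + s2.
Proof. by rewrite ltr_wpDl// mulr_ge0// sqr_ge0. Qed.

Let lam_ge0 n w : 0 <= lam n w.
Proof. by rewrite divr_ge0 ?sqr_ge0// mulr_ge0// ltW. Qed.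

Let lam_c n w : lam n w * c n w <= N n w ^+ 2 / 4.
Proof.
rewrite /lam /c; have := lam_den n w; have := sqr_ge0 (N n w); rewrite /s2.
set t := N n w ^+ 2; set b := sigma ^+ 2 => t0 l0.
have -> : t / (4 * (beta * t + (b + 1))) * (beta * t + b) =
   t / 4 - t / (4 * (beta * t + (b + 1))) by field; rewrite gt_eqF.
by rewrite gerBl divr_ge0// mulr_ge0// ltW.
Qed.

Let lam_le n w : lam n w <= N n w ^+ 2.
Proof.
rewrite ler_pdivrMr ?mulr_gt0// ler_peMr ?sqr_ge0// /s2.
have := sqr_ge0 sigma; have := mulr_ge0 beta_ge0 (sqr_ge0 (N n w)); lra.
Qed.

Let U_step n w : U n.+1 w <= U n w - alpha * (x n w * p n w) +
  alpha * (lam n w * x n w * gam n w ^+ 2) + alpha / 4 * (x n w * N n w ^+ 2).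
Proof.
have NL : N n.+1 w <= N n w + L * (alpha * x n.+1 w * gam n w) by exact: N_rec.
have xp : 0 < x n.+1 w by apply: powR_gt0.
have pN : p n w <= N n w * gam n w by apply: le_trans (ler_norm _) (p_le n w).
have := lyapunov_step L_ge0 alpha_gt0 beta_ge0 s2_gt0 xp (x_nd n w) (x_le n w)
  (N_ge0 n w) (N_ge0 n.+1 w) (gam_ge0 n w) pN NL (g_rec n w).
rewrite -/K -/(lam n w) => H.
have := ler_wpM2l K_ge0 (step_sqr n w); rewrite /U.
set a := S n w `^ _; set b := S n.+1 w `^ _; move: H; set e := x n.+1 w * gam n w => H.
rewrite [X in _ <= X](_ : _ = K / (2 * q - 1) * a - K / (2 * q - 1) * b); last by ring.
move: H; lra.
Qed.

Let U_ge0 n w : 0 <= U n w.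
Proof.
have a0 := ltW alpha_gt0.
rewrite /U !addr_ge0// ?(mulr_ge0 (mulr_ge0 a0 beta_ge0))// ?mulr_ge0 ?sqr_ge0//.
- exact: ltW.
- by rewrite invr_ge0 ltW.
- exact: powR_ge0.
Qed.

Let bounded_U n : bounded_rv (U n).
Proof.
rewrite /U; apply: bounded_rvD; [apply: bounded_rvD; [apply: bounded_rvD => //|]|].
- apply: bounded_rvM; first exact: bounded_rv_cst.
  by apply: bounded_rvM => //; exact: bounded_rvX.
- by apply: bounded_rvM => //; exact: bounded_rv_cst.
apply: bounded_rvM; first exact: bounded_rv_cst.
apply: (@bounded_rvP _ _ _ (S0 `^ (1 - 2 * q))) => // w; exact: powR_ge0.
Qed.

Let measurable_U n : measurable_wrt (F n) (U n).
Proof.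
have mc (k : R) : measurable_wrt (F n) (fun _ : T => k) by exact: measurable_cst.
do 2 (apply: (@measurable_funD _ (MT n)); [|by apply: (@measurable_funM _ (MT n)); [exact: mc|exact: measurable_powS]]).
apply: (@measurable_funD _ (MT n)).
  exact: measurable_g.
apply: (@measurable_funM _ (MT n)); first exact: mc.
by apply: (@measurable_funM _ (MT n)); [exact: measurable_powS|exact: measurable_N2].
Qed.

Let integrable_U n : Rintegrable P (U n).
Proof.
apply: Rintegrable_bounded => //; apply: (@measurable_wrt_sub _ T _ _ (F n)) => //; exact: measurable_U.
Qed.

Let measurable_lam n : measurable_wrt (F n) (lam n).
Proof.
rewrite (_ : lam n = (fun w => N n w ^+ 2 * (4 * (beta * N n w ^+ 2 + s2)) `^ (-1))); last first.
  by apply/funext => w; rewrite powR_inv1// mulr_ge0// ltW.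
have mc (k : R) : measurable_wrt (F n) (fun _ : T => k) by exact: measurable_cst.
apply: (@measurable_funM _ (MT n)); first exact: measurable_N2.
apply: (@measurableT_comp _ _ _ (MT n) _ _ (@powR R ^~ (-1))); first exact: measurable_powR.
apply: (@measurable_funM _ (MT n)); first exact: mc.
apply: (@measurable_funD _ (MT n)); last exact: mc.
by apply: (@measurable_funM _ (MT n)); [exact: mc|exact: measurable_N2].
Qed.

Let bounded_lam n : bounded_rv (lam n).
Proof.
have [M HM] := bounded_rvX 2 (bounded_N n).
apply: (@bounded_rvP _ _ _ M) => // w; apply: le_trans (lam_le n w) _.
exact: le_trans (ler_norm _) (HM w).
Qed.

(** The weighted form of [E[U_(n+1) | F_n] <= U_n - alpha / 2 S_n^-q |grad g|^2]: of the
    full decrease [alpha], one quarter is spent on [lam |G|^2] and one quarter on the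
    telescoping of the [beta] term. *)
Let drift n (H : T -> R) : (forall w, 0 <= H w) -> measurable_wrt (F n) H -> bounded_rv H ->
  \int[P]_w (H w * U n.+1 w) <=
  \int[P]_w (H w * U n w) - alpha / 2 * \int[P]_w (H w * (x n w * N n w ^+ 2)).
Proof.
move=> H0 mH bH.
have mH' : measurable_fun [set: T] H by apply: (@measurable_wrt_sub _ T _ _ (F n)).
have mHx : measurable_wrt (F n) (fun w => H w * x n w).
  by apply: (@measurable_funM _ (MT n)); [exact: mH|exact: measurable_powS].
have bHx : bounded_rv (fun w => H w * x n w) by exact: bounded_rvM.
have mHl : measurable_wrt (F n) (fun w => H w * x n w * lam n w).
  by apply: (@measurable_funM _ (MT n)); [exact: mHx|exact: measurable_lam].
have bHl : bounded_rv (fun w => H w * x n w * lam n w) by exact: bounded_rvM.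
have Hl0 w : 0 <= H w * x n w * lam n w by apply: mulr_ge0 => //; exact: mulr_ge0.
have [ip Ep] := expect_inner mHx bHx.
have [ig Eg] := expect_gam2 Hl0 mHl bHl.
have mT (f : T -> R) : measurable_wrt (F n) f -> bounded_rv f -> Rintegrable P f.
  by move=> mf bf; apply: Rintegrable_bounded => //; apply: (@measurable_wrt_sub _ T _ _ (F n)).
have iN : Rintegrable P (fun w => H w * x n w * N n w ^+ 2).
  apply: mT; first by apply: (@measurable_funM _ (MT n)); [exact: mHx|exact: measurable_N2].
  by apply: bounded_rvM => //; exact: bounded_rvX.
have ilc : Rintegrable P (fun w => H w * x n w * lam n w * c n w).
  apply: mT; first by apply: (@measurable_funM _ (MT n)); [exact: mHl|exact: measurable_c].
  exact: bounded_rvM.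
have iHU k : Rintegrable P (fun w => H w * U k w) by exact: RintegrableM_bounded.
set A := \int[P]_w (H w * x n w * N n w ^+ 2).
have -> : \int[P]_w (H w * (x n w * N n w ^+ 2)) = A.
  by apply: eq_Rintegral => w _; rewrite mulrA.
have Elc : \int[P]_w (H w * x n w * lam n w * c n w) <= 4^-1 * A.
  rewrite /A -RintegralZl//; apply: le_Rintegral => //; first exact: RintegrableZ.
  move=> w _; rewrite -mulrA [leRHS]mulrCA ler_wpM2l// ?mulr_ge0//.
  by rewrite [leRHS]mulrC lam_c.
have i1 := RintegrableZ (- alpha) ip.
have i2 := RintegrableZ alpha ig.
have i3 := RintegrableZ (alpha / 4) iN.
have i12 := RintegrableD (iHU n) i1.
have i123 := RintegrableD i12 i2.
apply: (@le_trans _ _ (\int[P]_w (H w * U n w + - alpha * (H w * x n w * p n w)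
   + alpha * (H w * x n w * lam n w * gam n w ^+ 2) + alpha / 4 * (H w * x n w * N n w ^+ 2)))).
  apply: le_Rintegral => //; first exact: RintegrableD.
  move=> w _; have := ler_wpM2l (H0 w) (U_step n w).
  move=> /le_trans; apply; rewrite le_eqVlt; apply/orP; left; apply/eqP; ring.
rewrite !RintegralD// !RintegralZl//; move: Eg Elc; rewrite Ep -/A.
set a := \int[P]_w (H w * U n w); set b := \int[P]_w (_ * gam n w ^+ 2); set e := \int[P]_w (_ * c n w).
move: alpha_gt0 => a0 be eA.
have : alpha * b <= alpha * (4^-1 * A) by rewrite ler_pM2l// (le_trans be).
lra.
Qed.

Let integrable_zeta n : Rintegrable P (fun w => x n w * N n w ^+ 2).
Proof.
apply: Rintegrable_bounded; last by apply: bounded_rvM => //; exact: bounded_rvX.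
apply: (@measurable_wrt_sub _ T _ _ (F n)) => //.
by apply: (@measurable_funM _ (MT n)); [exact: measurable_powS|exact: measurable_N2].
Qed.

Let supermartingale_U n A : F n A ->
  \int[P]_(w in A) U n.+1 w <= \int[P]_(w in A) U n w.
Proof.
move=> FA.
have mA : measurable_wrt (F n) (fun w => (\1_A w : R)).
  apply: (@measurable_indic _ (MT n)); exact: sub_sigma_algebra.
have A0 w : 0 <= (\1_A w : R) by rewrite indicE ler0n.
have bA : bounded_rv (fun w => (\1_A w : R)).
  by apply: (@bounded_rvP _ _ _ 1) => // w; rewrite indicE; case: (w \in A).
have E V : \int[P]_(w in A) V w = \int[P]_w (\1_A w * V w).
  rewrite Rintegral_mkcond; apply: eq_Rintegral => w _; rewrite patchE indicE.
  by case: (w \in A); rewrite ?mul1r ?mul0r.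
have a2 : 0 <= alpha / 2 by rewrite divr_ge0// ltW.
rewrite !E (le_trans (drift A0 mA bA))// gerBl mulr_ge0//.
by apply: Rintegral_ge0 => w _; rewrite mulr_ge0// mulr_ge0// sqr_ge0.
Qed.

Let energy_decrease n : alpha / 2 * \int[P]_w (x n w * N n w ^+ 2) <=
  \int[P]_w U n w - \int[P]_w U n.+1 w.
Proof.
have m1 : measurable_wrt (F n) (fun _ : T => 1 : R) by exact: measurable_cst.
have := drift (fun=> ler01) m1 (bounded_rv_cst T 1).
have E V : \int[P]_w (1 * V w) = \int[P]_w V w.
  by apply: eq_Rintegral => w _; rewrite mul1r.
by rewrite !E lerBrDr lerBrDl.
Qed.

Let expected_zeta : bounded_sums (fun n => \int[P]_w (x n w * N n w ^+ 2)).
Proof.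
exists (2 / alpha * \int[P]_w U 0%N w) => n.
have a2 : 0 < alpha / 2 by rewrite divr_gt0.
rewrite -(ler_pM2l a2) mulrA (_ : alpha / 2 * (2 / alpha) = 1); last first.
  by field; rewrite gt_eqF.
rewrite mul1r mulr_sumr.
apply: (@le_trans _ _ (\sum_(0 <= k < n) ((- \int[P]_w U k.+1 w) - (- \int[P]_w U k w)))).
  by apply: ler_sum => k _; rewrite opprK [leRHS]addrC; exact: energy_decrease.
rewrite telescope_sumr// opprK addrC gerBl.
exact: Rintegral_ge0.
Qed.

Lemma adagrad_sum : {ae P, forall w, bounded_sums (fun n =>
  S n w `^ (- q) * enorm (grad g (theta n w)) ^+ 2)}.
Proof.
apply: (@ae_bounded_sums _ _ _ P (fun n w => x n w * N n w ^+ 2)) => //.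
by move=> k w; rewrite mulr_ge0// sqr_ge0.
Qed.

(** Where [N > e], the second moment of [G] is at most a multiple of [N^2]. *)
Let sum_noise e : 0 < e -> {ae P, forall w,
  bounded_sums (fun n => (e < N n w)%R%:R * (x n w * gam n w ^+ 2))}.
Proof.
move=> e0; pose H n w := (e < N n w)%R%:R * x n w.
pose B := beta + sigma ^+ 2 / e ^+ 2.
have H0 n w : 0 <= H n w by apply: mulr_ge0 => //; exact: ler0n.
have mH n : measurable_wrt (F n) (H n).
  apply: (@measurable_funM _ (MT n)); last exact: measurable_powS.
  rewrite (_ : (fun w => _) = (fun w => if e ^+ 2 < N n w ^+ 2 then 1 else 0 : R)); last first.
    apply/funext => w; rewrite ltr_pXn2r ?nnegrE ?N_ge0 ?(ltW e0)//.
    by case: (e < N n w)%R.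
  apply: (@measurable_fun_if _ _ (MT n)) => //.
  apply: (@measurable_fun_ltr _ (MT n) R setT (cst (e ^+ 2)) (fun w => N n w ^+ 2)).
    exact: measurable_cst.
  exact: measurable_N2.
have bH n : bounded_rv (H n).
  apply: bounded_rvM => //; exists 1 => w.
  by case: (e < N n w)%R; rewrite ?normr1 ?normr0.
have iH n : Rintegrable P (fun w => H n w * c n w).
  by apply: RintegrableM_bounded => //; apply: (@measurable_wrt_sub _ T _ _ (F n)).
have iHg n : Rintegrable P (fun w => H n w * gam n w ^+ 2).
  exact: (expect_gam2 (H0 n) (mH n) (bH n)).1.
apply: (@ae_bounded_sums _ _ _ P (fun n w => (e < N n w)%R%:R * (x n w * gam n w ^+ 2))).
- by move=> n; apply: (eq_Rintegrable _ (iHg n)) => w; rewrite /H mulrA.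
- by move=> n w; rewrite mulrA; apply: mulr_ge0; [exact: H0|exact: sqr_ge0].
have B0 : 0 <= B by rewrite addr_ge0// divr_ge0// sqr_ge0.
apply: le_bounded_sums (bounded_sumsZ B0 expected_zeta) => n.
have -> : \int[P]_w ((e < N n w)%R%:R * (x n w * gam n w ^+ 2)) =
    \int[P]_w (H n w * gam n w ^+ 2) by apply: eq_Rintegral => w _; rewrite /H mulrA.
apply: (le_trans (expect_gam2 (H0 n) (mH n) (bH n)).2).
rewrite -RintegralZl//; apply: le_Rintegral => //; first exact: RintegrableZ.
move=> w _; rewrite /H; case: (ltP e (N n w)) => eN; last first.
  by rewrite !mul0r mulr_ge0// mulr_ge0// sqr_ge0.
rewrite mul1r mulrCA ler_wpM2l// /c /B mulrDl lerD2l.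
rewrite -mulrA ler_peMr ?sqr_ge0// mulrC ler_pdivlMr ?exprn_gt0// mul1r.
by rewrite lerXn2r ?nnegrE ?N_ge0 ?(ltW e0) ?(ltW eN).
Qed.

Let energy_cvg : {ae P, forall w, cvgn (U^~ w)}.
Proof. exact: (supermartingale_cvg filtF). Qed.

(** The other terms of the energy are convergent: [S] is nondecreasing and bounded below, and
    [S_n^-q |grad g|^2] is summable. *)
Lemma adagrad_cvg : {ae P, forall w, cvgn (fun n => g (theta n w))}.
Proof.
apply: filterS2 energy_cvg adagrad_sum => w Uc sN.
have pow_cvg r : 0 <= r -> cvgn (fun n => S n w `^ (- r)).
  move=> r0; apply: nonincreasing_is_cvgn.
    by move=> n k nk; apply: power_decreasing => //; exact: S_nd.
  by exists 0 => _ [n _ <-]; exact: powR_ge0.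
have zeta0 : (fun n => x n w * N n w ^+ 2) @ \oo --> (0 : R).
  apply/cvgrPdist_le => e e0.
  have z0 n : 0 <= x n w * N n w ^+ 2 by rewrite mulr_ge0// sqr_ge0.
  have [M HM] := bounded_sums_small z0 sN e0.
  by exists M => // n /= /HM; rewrite sub0r normrN ger0_norm.
have gE : (fun n => g (theta n w)) = (fun n => U n w - alpha * beta * (x n w * N n w ^+ 2)
    - alpha * s2 * x n w - K / (2 * q - 1) * S n w `^ (- (2 * q - 1))).
  by apply/funext => n; rewrite /U opprB; ring.
rewrite gE; apply: is_cvgB; [apply: is_cvgB; [apply: is_cvgB => //|]|].
- apply: is_cvgMr; apply/cvg_ex; exists 0; exact: zeta0.
- by apply: is_cvgMr; exact: pow_cvg.
- by apply: is_cvgMr; apply: pow_cvg; exact: ltW.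
Qed.

Lemma adagrad_grad0 : q <= 1 ->
  {ae P, forall w, enorm (grad g (theta n w)) @[n --> \oo] --> (0 : R)}.
Proof.
move=> q1.
have noise : {ae P, forall w, forall k : nat,
    bounded_sums (fun n => ((k.+1%:R)^-1 < N n w)%R%:R * (x n w * gam n w ^+ 2))}.
  by apply: ae_foralln => k; apply: sum_noise; rewrite invr_gt0.
apply: filterS2 adagrad_sum noise => w sN sk.
apply: (@gradient_to_zero R q (L * alpha) (S^~ w) (gam^~ w) (N^~ w)) => //.
- by rewrite mulr_ge0// ltW.
- by move=> n; rewrite mulrA -[L * alpha * _]mulrA -!mulrA; have := N_rec n w; rewrite -!mulrA.
move=> e e0; have [k /= _ /(_ _ (leqnn k)) ke] := near_infty_natSinv_lt (PosNum e0).
apply: le_bounded_sums (sk k) => n; apply: ler_wpM2r; first by apply: mulr_ge0; [exact: powR_ge0|exact: sqr_ge0].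
rewrite ler_nat; case: (ltP e) => // eN.
by rewrite (lt_trans ke eN).
Qed.

Theorem adagrad_convergence :
  [/\ {ae P, forall w, cvgn (fun n => g (theta n w))},
      {ae P, forall w, bounded_sums (fun n =>
        S n w `^ (- q) * enorm (grad g (theta n w)) ^+ 2)} &
      q <= 1 ->
        {ae P, forall w, enorm (grad g (theta n w)) @[n --> \oo] --> (0 : R)}].
Proof. by split; [exact: adagrad_cvg|exact: adagrad_sum|exact: adagrad_grad0]. Qed.

End AdaGrad.

(** In dimension [0] the Lipschitz condition does not force [L] to be nonnegative. *)
Lemma enorm_lip_max (R : realType) (m : nat) (f : 'rV[R]_m -> 'rV[R]_m) (L : R) :
  (forall x y, enorm (f x - f y) <= L * enorm (x - y)) ->
  forall x y, enorm (f x - f y) <= Num.max L 0 * enorm (x - y).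
Proof.
move=> lip x y; rewrite (le_trans (lip x y))// ler_wpM2r ?enorm_ge0//.
by rewrite le_max lexx.
Qed.

Theorem theorem3 (d : measure_display) (T : measurableType d) (R : realType)
  (P : probability T R) (F : nat -> set (set T)) (m : nat)
  (g : 'rV[R]_m -> R) (L q alpha0 S0 beta sigma : R) (theta1 : 'rV[R]_m)
  (theta G : nat -> T -> 'rV[R]_m) (S : nat -> T -> R)
  (EG : nat -> T -> 'rV[R]_m) (EG2 : nat -> T -> \bar R)
  (F_filtration : filtration F)
  (g_ge0 : forall x, 0 <= g x)
  (g_C1 : continuously_differentiable g)
  (grad_Lipschitz : forall x y,
     enorm (grad g x - grad g y) <= L * enorm (x - y))
  (q_gt : 1 / 2 < q)
  (S0_gt0 : 0 < S0) (alpha0_gt0 : 0 < alpha0)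
  (beta_ge0 : 0 <= beta) (sigma_ge0 : 0 <= sigma)
  (theta_meas : forall n, (1 <= n)%N -> vec_measurable_wrt (F n.-1) (theta n))
  (S_meas : forall n, (1 <= n)%N -> measurable_wrt (F n.-1) (S n.-1))
  (G_meas : forall n, (1 <= n)%N -> vec_measurable_wrt (F n) (G n))
  (theta_init : forall w, theta 1%N w = theta1)
  (S_init : forall w, S 0%N w = S0)
  (S_rec : forall n w, (1 <= n)%N -> S n w = S n.-1 w + enorm (G n w) ^+ 2)
  (theta_rec : forall n w, (1 <= n)%N ->
     theta n.+1 w = theta n w - (alpha0 * S n w `^ (- q)) *: G n w)
  (EG_version : forall n, (1 <= n)%N ->
     vec_cond_exp_version P (F n.-1) (G n) (EG n))
  (EG2_version : forall n, (1 <= n)%N ->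
     cond_exp_version P (F n.-1) (fun w => (enorm (G n w) ^+ 2)%:E) (EG2 n))
  (unbiased : {ae P, forall w, forall n, (1 <= n)%N ->
     EG n w = grad g (theta n w)})
  (second_moment : {ae P, forall w, forall n, (1 <= n)%N ->
     (EG2 n w <=
       (beta * enorm (grad g (theta n w)) ^+ 2 + sigma ^+ 2)%:E)%E}) :
  [/\ exists X : {RV P >-> R},
        {ae P, forall w, g (theta n w) @[n --> \oo] --> (X w : R)},
      {ae P, forall w,
        (ereal_sup [set (g (theta n w))%:E | n in [set n | (1 <= n)%N]]
           < +oo)%E},
      {ae P, forall w,
        (\sum_(1 <= n <oo)
           (enorm (grad g (theta n w)) ^+ 2 / S n.-1 w `^ q)%:E < +oo)%E} &
      q <= 1 ->
        {ae P, forall w, enorm (grad g (theta n w)) @[n --> \oo] --> (0 : R)}].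
Proof.
pose th n := theta n.+1; pose G' n := G n.+1.
have L0 : 0 <= Num.max L 0 by rewrite le_max lexx orbT.
have lip := enorm_lip_max grad_Lipschitz.
have tm n : vec_measurable_wrt (F n) (th n) := theta_meas _ (ltn0Sn n).
have Sm n : measurable_wrt (F n) (S n) := S_meas _ (ltn0Sn n).
have Gm n : vec_measurable_wrt (F n.+1) (G' n) := G_meas _ (ltn0Sn n).
have Srec n w : S n.+1 w = S n w + enorm (G' n w) ^+ 2 := S_rec _ w (ltn0Sn n).
have trec n w : th n.+1 w = th n w - (alpha0 * S n.+1 w `^ (- q)) *: G' n w :=
  theta_rec _ w (ltn0Sn n).
have EGv n : vec_cond_exp_version P (F n) (G' n) (EG n.+1) := EG_version _ (ltn0Sn n).
have EG2v n : cond_exp_version P (F n) (fun w => (enorm (G' n w) ^+ 2)%:E) (EG2 n.+1) :=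
  EG2_version _ (ltn0Sn n).
have unb n : {ae P, forall w, EG n.+1 w = grad g (th n w)}.
  by apply: filterS unbiased => w; apply.
have sec n : {ae P, forall w, (EG2 n.+1 w <=
    (beta * enorm (grad g (th n w)) ^+ 2 + sigma ^+ 2)%:E)%E}.
  by apply: filterS second_moment => w; apply.
have [g_cvg sum_fin grad0] := adagrad_convergence F_filtration g_ge0 g_C1 L0 lip q_gt S0_gt0
  alpha0_gt0 beta_ge0 tm Sm Gm theta_init S_init Srec trec EGv EG2v unb sec.
split.
(* The limit exists only almost surely; the upper limit is defined everywhere. *)
- pose X0 w := limn_esup (fun n => (g (th n w))%:E).
  have mX : measurable_fun [set: T] (fine \o X0).
    apply: measurableT_comp => //; apply: measurable_fun_limn_esup => n.
    apply/measurable_EFinP; apply: measurable_comp_rV => [v|i].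
      by apply: differentiable_continuous; exact: (proj1 g_C1).
    case: F_filtration => sF Fm _.
    by apply: (@measurable_wrt_sub _ T _ _ (F n)) => //; exact: tm.
  pose X : {RV P >-> R} := HB.pack (fine \o X0) (isMeasurableFun.Build _ _ _ _ _ mX).
  exists X; apply: filterS g_cvg => w /cvg_ex[/= l gl].
  rewrite -cvg_shiftS /=.
  have -> : fine (X0 w) = l.
    have El : (g (th n w))%:E @[n --> \oo] --> l%:E by apply: cvg_EFin => //; exact: nearW.
    rewrite /X0 is_cvg_limn_esupE; first by rewrite (cvg_lim _ El).
    by apply/cvg_ex; exists l%:E.
  exact: gl.
- apply: filterS g_cvg => w gc.
  have /bounded_fun_has_ubound[M HM] := cvg_seq_bounded gc.
  apply: (@le_lt_trans _ _ M%:E); last exact: ltry.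
  apply: ge_ereal_sup => _ [[//|n] _ <-]; rewrite lee_fin; apply: HM.
  by exists n.
- apply: filterS sum_fin => w [M HM].
  apply: (@le_lt_trans _ _ M%:E); last exact: ltry.
  apply: lime_le.
    by apply: is_cvg_nneseries => n _ _; rewrite lee_fin divr_ge0 ?sqr_ge0 ?powR_ge0.
  apply: nearW => -[|n]; first by rewrite big_geq// lee_fin (le_trans _ (HM 0%N))// big_geq.
  rewrite big_add1 /= sumEFin lee_fin (le_trans _ (HM n))//.
  by apply: ler_sum => k _; rewrite powRN mulrC.
move=> /grad0; apply: filterS => w.
by rewrite -[X in _ -> X]cvg_shiftS.
Qed.
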